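(* Let $(\Xi,|\cdot|)$ be a normed space, and let $\Phi$ and $\Psi_\xi$, $\xi\in\Xi$, be measurable linear cocycles over $\theta$ with generators $A$ and $B_\xi$ respectively. Assume: (A1) $\Phi$ has a tempered exponential dichotomy on $\widetilde\Omega\subset\Omega$ with exponent $\alpha:\Omega\to(0,+\infty)$ and bound $K:\Omega\to(0,+\infty)$; (A2) for every $\omega\in\widetilde\Omega$ and $\xi\in\Xi$, $\|A(\omega)-B_\xi(\omega)\|\le\frac{\rho(\omega)}{K(\theta\omega)}$, where $\rho:\Omega\to(0,+\infty)$ is a $\theta$-invariant random variable such that $\rho(\omega)<\frac{1-e^{-\alpha(\omega)}}{1+e^{-\alpha(\omega)}}$ for all $\omega\in\Omega$; (A3) for every $\omega\in\widetilde\Omega$ and $\xi_1,\xi_2\in\Xi$, $\|B_{\xi_1}(\omega)-B_{\xi_2}(\omega)\|\le\frac{\upsilon(\omega)|\xi_1-\xi_2|^\sigma}{K(\theta\omega)}$, where $\upsilon:\Omega\to(0,+\infty)$ is a $\theta$-invariant random variable and $\sigma\in(0,1]$ is a constant. Then for every $\xi\in\Xi$ the cocycle $\Psi_\xi$ has a tempered exponential dichotomy on $\widetilde\Omega$, with the same exponent $\widetilde\alpha:\Omega\to(0,+\infty)$ and the same bound $\widetilde K:\Omega\to(0,+\infty)$ for all $\xi\in\Xi$. Moreover, the corresponding projections $\widetilde\Pi_\xi(\omega)$ are Hölder continuous in $\xi$ with Hölder exponent $\sigma$; that is, for each $\omega\in\widetilde\Omega$ the map $\xi\mapsto\widetilde\Pi_\xi(\omega)\in\mathcal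 L(X)$ is Hölder continuous with exponent $\sigma$.
   Context: Notation. $X=(X,|\cdot|)$ is a separable Banach space; $\mathcal L(X)$ is the Banach space of bounded linear operators on $X$ with operator norm $\|\cdot\|$; $\mathcal R(P)$ is the range of $P$; $\mathbb Z_+$ (resp. $\mathbb Z_-$) is the set of nonnegative (resp. nonpositive) integers. $(\Omega,\mathcal F,\mathbb P)$ is a measure space and $\theta:\Omega\to\Omega$ is an invertible measurable transformation (with measurable inverse) preserving $\mathbb P$. A random variable is a measurable function; a function $g$ on $\Omega$ is $\theta$-invariant if $g(\theta\omega)=g(\omega)$ for all $\omega$. A set $\widetilde\Omega$ is $\theta$-invariant if $\theta(\widetilde\Omega)=\widetilde\Omega$; full measure means null complement. Cocycles. A measurable linear cocycle over $\theta$ is a map $\Phi:\mathbb Z_+\times\Omega\to\mathcal L(X)$ with $\Phi(0,\omega)=\mathrm{Id}$, $\Phi(n+m,\omega)=\Phi(m,\theta^n\omega)\Phi(n,\omega)$ for all $\omega\in\Omega$, $n,m\in\mathbb Z_+$, and such that $\omega\mapsto\Phi(n,\omega)$ is strongly measurable for each $n$ (i.e. $\omega\mapsto\Phi(n,\omega)x$ is measurable for each $x\in X$). Its generator is $A(\omega):=\Phi(1,\omega)$. A random variable $K:\Omega\to(0,+\infty)$ is tempered (with respect to $\theta$) if $\lim_{n\to\pm\infty}\frac{\ln K(\theta^n\omega)}{n}=0$ for $\mathbb P$-a.e. $\omega\in\Omega$. Tempered exponential dichotomy. $\Phi$ has a tempered exponential dichotomy on a $\theta$-invariant (measurable) set $\widetilde\Omega\subset\Omega$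 of full measure, with exponent $\alpha$, bound $K$ and projections $\Pi^s(\omega)$, if $\Pi^s:\widetilde\Omega\to\mathcal L(X)$ is a strongly measurable map such that, with $\Pi^u(\omega):=\mathrm{Id}-\Pi^s(\omega)$: (i) $\Pi^s(\omega)$ is a projection for every $\omega\in\widetilde\Omega$; (ii) $\Pi^s(\theta^n\omega)\Phi(n,\omega)=\Phi(n,\omega)\Pi^s(\omega)$ for all $\omega\in\widetilde\Omega$, $n\in\mathbb Z_+$; (iii) $\Phi(n,\omega)|_{\mathcal R(\Pi^u(\omega))}$ is an isomorphism from $\mathcal R(\Pi^u(\omega))$ onto $\mathcal R(\Pi^u(\theta^n\omega))$ for all $\omega\in\widetilde\Omega$, $n\in\mathbb Z_+$, and $\omega\mapsto\Phi(n,\omega)\Pi^u(\omega)$ is strongly measurable for $n\in\mathbb Z_-$, where for $n\in\mathbb Z_-$, $\Phi(n,\omega):=(\Phi(-n,\theta^n\omega)|_{\mathcal R(\Pi^u(\theta^n\omega))})^{-1}$; (iv) $\alpha:\Omega\to(0,+\infty)$ is a $\theta$-invariant random variable and $K:\Omega\to(0,+\infty)$ is a tempered random variable such that $\|\Phi(n,\omega)\Pi^s(\omega)\|\le K(\omega)e^{-\alpha(\omega)n}$ for $\omega\in\widetilde\Omega$, $n\in\mathbb Z_+$, and $\|\Phi(n,\omega)\Pi^u(\omega)\|\le K(\omega)e^{\alpha(\omega)n}$ for $\omega\in\widetilde\Omega$, $n\in\mathbb Z_-$. The projections $\widetilde\Pi_\xi(\omega)$ in the claim are the projections $\Pi^s(\omega)$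 of the dichotomy of $\Psi_\xi$. *)

(* Defs.v *)
From HB Require Import structures.
From mathcomp Require Export all_boot all_order all_algebra.
From mathcomp Require Export all_classical all_reals all_analysis.
Export Order.TTheory GRing.Theory Num.Theory numFieldNormedType.Exports.

Set Implicit Arguments.
Unset Strict Implicit.
Unset Printing Implicit Defensive.

Global Open Scope classical_set_scope.
Global Open Scope ring_scope.

Section BoundedOperators.
Context {R : realType} {X : normedModType R}.

(* L(X) is handled as the functions X -> X satisfying this predicate; sums and
   compositions of operators are those of functions. *)
Definition bounded_operator (T : X -> X) : Prop :=
  linear T /\ exists M : R, forall x, `|T x| <= M * `|x|.

(* A real supremum: it is the operator norm for bounded operators only (the
   supremum of an unbounded set of reals is 0 by convention). *)
Definition opnorm (T : X -> X) : R :=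
  sup [set `|T x| | x in [set x : X | `|x| <= 1]].

Definition projection (T : X -> X) : Prop :=
  bounded_operator T /\ T \o T = T.

(* The restriction of the bounded operator T to the linear subspace E is an
   isomorphism of normed spaces onto F; the last clause is the boundedness of
   its inverse. *)
Definition isomorphism_between (E F : set X) (T : X -> X) : Prop :=
  set_bij E F T /\ exists M : R, forall x, E x -> `|x| <= M * `|T x|.

End BoundedOperators.

Definition separable (T : topologicalType) : Prop :=
  exists2 D : set T, countable D & dense D.

(* Measurability in X refers to its Borel sigma-algebra. *)
Definition strongly_measurable {R : realType} {X : normedModType R}
    {d : measure_display} {Omega : measurableType d}
    (D : set Omega) (T : Omega -> X -> X) : Prop :=
  forall x : X,
    measurable_fun D (fun w => T w x : g_sigma_algebraType (@open X)).

Section Dynamics.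
Context {R : realType} {X : normedModType R}.
Context {d : measure_display} {Omega : measurableType d}.
Variables (P : {measure set Omega -> \bar R}) (theta thetaV : Omega -> Omega).

Definition invertible_measure_preserving : Prop :=
  [/\ cancel theta thetaV, cancel thetaV theta,
      measurable_fun setT theta, measurable_fun setT thetaV &
      forall A, measurable A -> P (theta @^-1` A) = P A].

Definition positive_random_variable (g : Omega -> R) : Prop :=
  measurable_fun setT g /\ forall w, 0 < g w.

Definition invariant_fun (g : Omega -> R) : Prop :=
  forall w, g (theta w) = g w.

Definition invariant_full_measure_set (W : set Omega) : Prop :=
  [/\ measurable W, theta @` W = W & P (~` W) = 0%E].

(* The second limit is the one for n -> -oo, with -n in place of n. *)
Definition tempered (K : Omega -> R) : Prop :=
  {ae P, forall w,
    (fun n => ln (K (iter n theta w)) / n%:R) @ \oo --> (0 : R) /\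
    (fun n => ln (K (iter n thetaV w)) / (- n%:R)) @ \oo --> (0 : R)}.

Definition measurable_linear_cocycle (Phi : nat -> Omega -> X -> X) : Prop :=
  [/\ forall n w, bounded_operator (Phi n w),
      forall w, Phi 0%N w = id,
      forall n m w, Phi (n + m)%N w = Phi m (iter n theta w) \o Phi n w &
      forall n, strongly_measurable setT (Phi n)].

Definition generator (Phi : nat -> Omega -> X -> X) : Omega -> X -> X :=
  Phi 1%N.

Definition compl_proj (Pis : Omega -> X -> X) (w : Omega) : X -> X :=
  fun x => x - Pis w x.

(* [cocycle_neg Phi Pis m w] is Phi(-m, w) for m >= 0, the inverse of the
   restriction of Phi(m, theta^(-m) w) to R(Pi^u(theta^(-m) w)); it is
   meaningful on R(Pi^u(w)). *)
Definition cocycle_neg (Phi : nat -> Omega -> X -> X) (Pis : Omega -> X -> X)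
    (m : nat) (w : Omega) : X -> X :=
  let w' := iter m thetaV w in
  'pinv_(fun=> 0) (range (compl_proj Pis w')) (Phi m w').

(* Pis is a total function, but only its values on W matter. *)
Record tempered_exponential_dichotomy (Phi : nat -> Omega -> X -> X)
    (W : set Omega) (alpha K : Omega -> R) (Pis : Omega -> X -> X) : Prop := {
  ted_set : invariant_full_measure_set W ;
  ted_measurable : strongly_measurable W Pis ;
  ted_projection : forall w, W w -> projection (Pis w) ;
  ted_commute : forall w n, W w ->
    Pis (iter n theta w) \o Phi n w = Phi n w \o Pis w ;
  ted_isomorphism : forall w n, W w ->
    isomorphism_between (range (compl_proj Pis w))
      (range (compl_proj Pis (iter n theta w))) (Phi n w) ;
  ted_neg_measurable : forall m, strongly_measurable W
    (fun w => cocycle_neg Phi Pis m w \o compl_proj Pis w) ;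
  ted_exponent : positive_random_variable alpha /\ invariant_fun alpha ;
  ted_bound : positive_random_variable K /\ tempered K ;
  ted_stable : forall w n, W w ->
    opnorm (Phi n w \o Pis w) <= K w * expR (- alpha w * n%:R) ;
  ted_unstable : forall w m, W w ->
    opnorm (cocycle_neg Phi Pis m w \o compl_proj Pis w)
      <= K w * expR (- alpha w * m%:R)
}.

End Dynamics.

Definition hoelder_continuous {R : realType} {X Xi : normedModType R}
    (sigma : R) (T : Xi -> X -> X) : Prop :=
  exists C : R, forall xi1 xi2,
    opnorm (T xi1 \- T xi2) <= C * `|xi1 - xi2| `^ sigma.

(* Main.v *)
Require Import Defs.
From mathcomp Require Import measurable_realfun zify ring lra.

Set Implicit Arguments.
Unset Strict Implicit.
Unset Printing Implicit Defensive.

(** Fix a point of [W] and follow its orbit, indexed by the integers. Write [A n]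
    and [B n] for the generators of the given and of the perturbed cocycle at time
    [n], and [a = exp (- alpha)]. The two halves of the given dichotomy solve
    [x (n + 1) = A n (x n) + h (n + 1)] explicitly by two geometrically convergent
    series ([response]), and the response to a source [h] with
    [K n * |h n| <= M] is bounded by [M (1 + a) / (1 - a)]. Since [B - A] is at most
    [rho / K (n + 1)], the factor [K] that the dichotomy loses is regained at each
    application of [B - A], so the equation
    [x (n + 1) = B n (x n) + h (n + 1)] is a contraction for the response, of ratio
    [rho (1 + a) / (1 - a) < 1] in the supremum norm. The inequality being strict,
    a ratio below one survives in the norm weighted by [s ^ |n|] for some [s > 1]
    ([rateP]). The solution [green m v] with the source [v] concentrated at time
    [m] therefore exists, is unique and decays like [s ^ - |n - m|].

    All of the perturbed dichotomy is read off this Green function. Its value at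
    time [m] is the stable projection: cutting the solution at time [m] gives
    another solution ([green_truncate]), hence idempotence, and moving the source
    one step along [B] changes the solution by its jump only ([green_step]), hence
    the commutation with the cocycle. Its values at later times are the stable
    evolution; its values at earlier times are, up to sign, the inverses of the
    cocycle on the unstable spaces ([branch_cocycle], [branch_inverse],
    [green_dichotomy]). The exponent [ln s] and the constants involve only [alpha],
    [rho] and [K], so they are common to all perturbations. The difference of two
    Green functions solves the perturbed equation with a source proportional to
    the difference of the generators ([green_perturbation]), whence the Hoelder
    estimate.

    Two points need care. The bound [K] is tempered only almost everywhere, so along
    an exceptional orbit of [W] it may grow exponentially and a bounded
    homogeneous solution cannot be shown to vanish by comparing with [K].
    Uniqueness is proved instead in the class [tame], where the size of [x n] is
    measured through its whole stable future and unstable past; every response to a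
    source as above belongs to this class. For the measurability of the projections, the Green function is kept as
    an explicit limit of sums of compositions, and in a separable space strongly
    measurable families of operators can be applied to measurable vectors
    ([measurable_superposition]). *)

(** * Bounded operators *)

Section BoundedOperatorTheory.
Context {R : realType} {X : normedModType R}.
Implicit Types T : X -> X.

Lemma bounded_operator_sub T : bounded_operator T ->
  forall x y, T (x - y) = T x - T y.
Proof.
move=> [Tl _] x y.
by rewrite addrC -scaleN1r Tl scaleN1r addrC.
Qed.

Lemma bounded_operator0 T : bounded_operator T -> T 0 = 0.
Proof. by move=> bT; have := bounded_operator_sub bT 0 0; rewrite !subrr. Qed.

Lemma bounded_operatorN T : bounded_operator T -> forall x, T (- x) = - T x.
Proof.
by move=> bT x; rewrite -sub0r bounded_operator_sub // bounded_operator0 // sub0r.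
Qed.

Lemma bounded_operatorD T : bounded_operator T ->
  forall x y, T (x + y) = T x + T y.
Proof.
move=> bT x y; have := bounded_operator_sub bT x (- y).
by rewrite (bounded_operatorN bT) !opprK.
Qed.

Lemma bounded_operatorZ T : bounded_operator T ->
  forall c x, T (c *: x) = c *: T x.
Proof.
move=> bT c x; have [Tl _] := bT.
by have := Tl c x 0; rewrite (bounded_operator0 bT) !addr0.
Qed.

Lemma bounded_operator_sum T (u : nat -> X) n : bounded_operator T ->
  T (\sum_(0 <= i < n) u i) = \sum_(0 <= i < n) T (u i).
Proof.
move=> bT; elim: n => [|n IH]; first by rewrite !big_nil bounded_operator0.
by rewrite !big_nat_recr //= bounded_operatorD // IH.
Qed.

Lemma bounded_operator_comp T1 T2 : bounded_operator T1 ->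
  bounded_operator T2 -> bounded_operator (T1 \o T2).
Proof.
move=> [l1 [M1 b1]] [l2 [M2 b2]]; split.
  by move=> c x y /=; rewrite l2 l1.
exists (`|M1| * M2) => x /=.
apply: le_trans (b1 _) _; rewrite -mulrA.
apply: (@le_trans _ _ (`|M1| * `|T2 x|)).
  by rewrite ler_wpM2r // ler_norm.
by rewrite ler_wpM2l.
Qed.

Lemma bounded_operatorB T1 T2 : bounded_operator T1 ->
  bounded_operator T2 -> bounded_operator (T1 \- T2).
Proof.
move=> [l1 [M1 b1]] [l2 [M2 b2]]; split.
  by move=> c x y /=; rewrite l2 l1 scalerBr opprD addrACA.
exists (M1 + M2) => x /=; rewrite mulrDl.
exact: le_trans (ler_normB _ _) (lerD _ _).
Qed.

Lemma bounded_operator_id : bounded_operator (@id X).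
Proof. by split=> //; exists 1 => x; rewrite mul1r. Qed.

Lemma bounded_operator_continuous T : bounded_operator T -> continuous T.
Proof.
move=> bT x; have [_ [M bM]] := bT.
apply/cvgrPdist_lt => e e0.
have M0 : 0 < `|M| + 1 by rewrite ltr_pwDr.
near=> y; rewrite -bounded_operator_sub //.
apply: le_lt_trans (bM _) _.
apply: (@le_lt_trans _ _ ((`|M| + 1) * `|x - y|)).
  by rewrite ler_wpM2r // (le_trans (ler_norm M)) // lerDl.
rewrite mulrC -ltr_pdivlMr //.
near: y; apply: cvgr_dist_lt; by [exact: cvg_id|rewrite divr_gt0].
Unshelve. all: by end_near. Qed.

Lemma opnorm_bound T x : bounded_operator T -> `|T x| <= opnorm T * `|x|.
Proof.
move=> bT; have [Tl [M bM]] := bT.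
have [->|x0] := eqVneq x 0.
  by rewrite bounded_operator0 // !normr0 mulr0.
have nx0 : 0 < `|x| by rewrite normr_gt0.
rewrite -ler_pdivrMr //.
have -> : `|T x| / `|x| = `|T (`|x|^-1 *: x)|.
  by rewrite (bounded_operatorZ bT) normrZ normfV normr_id mulrC.
apply: (@ub_le_sup R _ _ _).
  exists `|M| => _ [y /= y1 <-].
  apply: le_trans (bM _) _.
  apply: (@le_trans _ _ (`|M| * `|y|)); first by rewrite ler_wpM2r // ler_norm.
  by rewrite -[leRHS]mulr1 ler_wpM2l.
exists (`|x|^-1 *: x) => //=.
by rewrite normrZ normfV normr_id mulVf // gt_eqF.
Qed.

Lemma opnorm_le T M : 0 <= M -> (forall x, `|T x| <= M * `|x|) -> opnorm T <= M.
Proof.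
move=> M0 bM; apply: ge_sup; first by exists `|T 0|, 0 => //=; rewrite normr0.
move=> _ [y /= y1 <-]; apply: le_trans (bM _) _.
by rewrite -[leRHS]mulr1 ler_wpM2l.
Qed.

Lemma opnorm_apply_le T M x : bounded_operator T -> opnorm T <= M ->
  `|T x| <= M * `|x|.
Proof.
by move=> bT TM; apply: le_trans (opnorm_bound _ bT) _; rewrite ler_wpM2r.
Qed.

End BoundedOperatorTheory.

(** * Geometrically dominated series *)

Section GeometricSeries.
Context {R : realType} {X : completeNormedModType R}.
Implicit Types u v : nat -> X.

Definition series_sum u : X := limn (series u).

Definition geo_dominated (r : R) u : Prop :=
  exists M, forall k, `|u k| <= M * r ^+ k.

Variable r : R.
Hypothesis r01 : 0 <= r < 1.

Lemma geometric_bound_cvg (M : R) u : (forall k, `|u k| <= M * r ^+ k) ->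
  cvgn [normed series u] /\ limn [normed series u] <= M / (1 - r).
Proof.
have [r0 r1] := andP r01.
have rn : `|r| < 1 by rewrite ger0_norm.
move=> uM; have cG : cvgn (series (geometric M r)).
  by apply/cvg_ex; exists (M / (1 - r)); exact: cvg_geometric_series.
have cu : cvgn [normed series u] by apply: (series_le_cvg _ _ uM cG) => k //;
  apply: le_trans (uM k).
split => //; apply: le_trans (lim_series_le cu cG uM) _.
by rewrite (cvg_lim _ (cvg_geometric_series rn)).
Qed.

Lemma series_sum_cvg u : geo_dominated r u -> series u @ \oo --> series_sum u.
Proof.
by move=> [M uM]; apply: normed_cvg; have [] := geometric_bound_cvg uM.
Qed.

Lemma series_sum_bound M u : (forall k, `|u k| <= M * r ^+ k) ->
  `|series_sum u| <= M / (1 - r).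
Proof.
move=> uM; have [cu lu] := geometric_bound_cvg uM.
exact: le_trans (lim_series_norm cu) lu.
Qed.

Lemma series_sum_unique u l : series u @ \oo --> l -> series_sum u = l.
Proof. exact: cvg_lim. Qed.

Lemma series_sumD u v : geo_dominated r u -> geo_dominated r v ->
  series_sum (fun k => u k + v k) = series_sum u + series_sum v.
Proof.
move=> gu gv; apply: series_sum_unique.
have -> : series (fun k => u k + v k) = (fun n => series u n + series v n).
  by apply/funext => n; rewrite /series /= big_split.
by apply: cvgD; exact: series_sum_cvg.
Qed.

Lemma series_sum_operator T u : bounded_operator T -> geo_dominated r u ->
  T (series_sum u) = series_sum (T \o u).
Proof.
move=> bT gu; apply/esym/series_sum_unique.
have -> : series (T \o u) = T \o series u.
  by apply/funext => n; rewrite /series /= bounded_operator_sum.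
exact: continuous_cvg (@bounded_operator_continuous _ _ _ bT _) (series_sum_cvg gu).
Qed.

Lemma geo_dominated_operator T u : bounded_operator T -> geo_dominated r u ->
  geo_dominated r (T \o u).
Proof.
move=> [_ [N TN]] [M uM]; exists (`|N| * M) => k.
apply: le_trans (TN _) _; apply: (@le_trans _ _ (`|N| * `|u k|)).
  by rewrite ler_wpM2r // ler_norm.
by rewrite -mulrA ler_wpM2l.
Qed.

Lemma geo_dominatedS u : geo_dominated r u ->
  geo_dominated r (fun k => u k.+1).
Proof.
by move=> [M uM]; exists (M * r) => k; rewrite -mulrA -exprS.
Qed.

Lemma series_sum_recl u : geo_dominated r u ->
  series_sum u = u 0%N + series_sum (fun k => u k.+1).
Proof.
move=> gu; suff -> : series_sum (fun k => u k.+1) = series_sum u - u 0%N.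
  by rewrite addrC subrK.
apply: series_sum_unique.
have -> : series (fun k => u k.+1) = (fun n => series u n.+1 - u 0%N).
  by apply/funext => n; rewrite /series /= big_nat_recl //= addrAC subrr add0r.
by apply: cvgB; [rewrite (cvg_shiftS (series u)); exact: series_sum_cvg|exact: cvg_cst].
Qed.

End GeometricSeries.

(** * Borel measurability in a separable Banach space *)

Section SeparableMeasurability.
Context {R : realType} {X : completeNormedModType R}.
Context {d : measure_display} {Omega : measurableType d}.
Hypothesis sepX : separable X.
Local Notation borelX := (g_sigma_algebraType (@open X)).
Implicit Types (D : set Omega) (f g : Omega -> borelX).

Lemma dense_sequence :
  exists e : nat -> X, forall x eps, 0 < eps -> exists n, `|x - e n| < eps.
Proof.
have [D cD dD] := sepX; have /(@pcard_surjP X) [e eD] := cD.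
exists e => x eps e0.
have oB : open_nbhs x (ball x eps).
  by split; [exact: ball_open|exact: ballxx].
have [||y [By Dy]] := dD (ball x eps); first by exists x; exact: ballxx.
  exact: ball_open.
by have [n _ en] := eD y Dy; exists n; rewrite en -ball_normE in By *.
Qed.

Lemma measurable_dist D f (c : X) :
  measurable_fun D f -> measurable_fun D (fun w => `|f w - c : X|).
Proof.
move=> mf.
suff mg : measurable_fun setT (fun x : borelX => `|(x : X) - c|).
  exact: (measurableT_comp mg mf).
apply: (measurability _ (RGenOpens.measurableE R)).
move=> _ [_ [a [b ->] <-]]; rewrite setTI; apply: sub_sigma_algebra.
have cg : continuous (fun x : X => `|x - c|).
  move=> x; apply: cvg_norm; apply: cvgB; [exact: cvg_id|exact: cvg_cst].
by move/continuousP: cg; apply; exact: interval_open.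
Qed.

(** In a separable space every open set is a countable union of balls, so only
    preimages of balls have to be tested. *)
Lemma measurable_of_dist D f :
  (forall c : X, measurable_fun D (fun w => `|f w - c : X|)) ->
  measurable_fun D f.
Proof.
move=> mf mD; have [e eP] := dense_sequence.
apply: (measurability _ (erefl : @measurable _ borelX = <<s @open X >>)) => //.
move=> _ [U oU <-].
pose F n k := if `[< forall y : X, `|y - e n| < k.+1%:R^-1 -> U y >]
  then D `&` (fun w => `|f w - e n : X|) @^-1` `]-oo, k.+1%:R^-1[ else set0.
have -> : D `&` f @^-1` U = \bigcup_n \bigcup_k F n k.
  apply/seteqP; split => [w [Dw /= Uw]|w [n _ [k _]]]; last first.
    rewrite /F; case: asboolP => // sU [Dw]; rewrite /= in_itv /= => fw.
    by split => //; exact: sU.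
  have := oU; rewrite openE => /(_ _ Uw) /nbhs_ballP [eps /= e0 eU].
  have [k ke] : exists k, k.+1%:R^-1 < eps / 2 :> R.
    have /ltr_add_invr [k] : 0 < eps / 2 by rewrite divr_gt0.
    by rewrite add0r => ?; exists k.
  have [n ne] := eP (f w) k.+1%:R^-1 ltac:(by rewrite invr_gt0).
  exists n => //; exists k => //; rewrite /F; case: asboolP => [_|[]].
    by split => //=; rewrite in_itv.
  move=> y ye; apply: eU; rewrite -ball_normE /=.
  have -> : (f w : X) - y = (f w - e n) - (y - e n) by rewrite opprB addrA subrK.
  apply: le_lt_trans (ler_normB _ _) _; rewrite [eps]splitr.
  by apply: ltrD; [exact: lt_trans ne ke|exact: lt_trans ye ke].
apply: bigcupT_measurable => n; apply: bigcupT_measurable => k.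
rewrite /F; case: asboolP => _; last exact: measurable0.
by apply: mf => //; exact: measurable_itv.
Qed.

Lemma measurable_limit D (f_ : nat -> Omega -> borelX) f :
  (forall n, measurable_fun D (f_ n)) ->
  (forall w, D w -> (fun n => f_ n w : X) @ \oo --> (f w : X)) ->
  measurable_fun D f.
Proof.
move=> mf cf; apply: measurable_of_dist => c.
apply: (measurable_fun_cvg
  (h := fun n w => `|f_ n w - c : X|)) => [n|w Dw]; first exact: measurable_dist.
by apply: cvg_norm; apply: cvgB; [exact: cf|exact: cvg_cst].
Qed.

(** Superposition of a Caratheodory map. The inner function is the limit of
    functions with values in a dense sequence (the first point of the sequence
    at distance less than [1/(k+1)]), for which the superposition is a countable
    gluing of measurable functions. *)
Lemma measurable_superposition D (F : Omega -> X -> borelX) f :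
  (forall x, measurable_fun D (F ^~ x)) ->
  (forall w, D w -> continuous (F w : X -> X)) ->
  measurable_fun D f -> measurable_fun D (fun w => F w (f w)).
Proof.
move=> mF cF mf; have [e eP] := dense_sequence.
have exP w k : exists n, `|(f w : X) - e n| < k.+1%:R^-1.
  by apply: eP; rewrite invr_gt0.
pose i k w := ex_minn (exP w k).
apply: (measurable_limit (f_ := fun k w => F w (e (i k w)))); last first.
  move=> w Dw.
  suff ci : (fun k => e (i k w)) @ \oo --> (f w : X).
    exact: continuous_cvg (cF w Dw _) ci.
  apply/cvgrPdist_lt => eps e0; near=> k.
  rewrite /i; case: ex_minnP => n ne _; apply: lt_trans ne _.
  by near: k; exact: near_infty_natSinv_lt (PosNum e0).
move=> k mD Y mY.
pose Q n := D `&` (fun w => `|(f w : X) - e n|) @^-1` `]-oo, k.+1%:R^-1[.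
have mQ n : measurable (Q n).
  by apply: (measurable_dist (e n) mf) => //; exact: measurable_itv.
have -> : D `&` (fun w => F w (e (i k w))) @^-1` Y =
    \bigcup_n ((Q n `\` \bigcup_(m < n) Q m) `&` (D `&` (F ^~ (e n)) @^-1` Y)).
  apply/seteqP; split => [w [Dw /= Yw]|w [n _ [[[Dw /= Qn] nQ] [_ Yw]]]].
    exists (i k w) => //; split => //; split.
      by split => //=; rewrite in_itv /= /i; case: ex_minnP.
    move=> [m /= mi [_ /=]]; rewrite in_itv /= => mk.
    move: mi; rewrite /i; case: ex_minnP => n _ /(_ _ mk) nm.
    by rewrite ltnNge nm.
  split => //=; suff -> : i k w = n by [].
  rewrite /i; case: ex_minnP => m mk mmin.
  rewrite in_itv /= in Qn; apply/eqP; rewrite eqn_leq mmin //= leqNgt.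
  apply/negP => mn; apply: nQ; exists m; first exact: mn.
  by split => //=; rewrite in_itv /=.
apply: bigcupT_measurable => n; apply: measurableI; last exact: mF.
by apply: measurableD => //; apply: bigcup_measurable.
Unshelve. all: by end_near. Qed.

Lemma measurable_operator_apply D (T : Omega -> X -> X) f :
  strongly_measurable D T -> (forall w, D w -> bounded_operator (T w)) ->
  measurable_fun D f -> measurable_fun D (fun w => T w (f w) : borelX).
Proof.
move=> mT bT mf; apply: (measurable_superposition (F := T)) => // w Dw.
by apply: bounded_operator_continuous; exact: bT.
Qed.

Lemma measurable_add D f g : measurable_fun D f -> measurable_fun D g ->
  measurable_fun D (fun w => (f w : X) + (g w : X) : borelX).
Proof.
move=> mf mg.
apply: (measurable_superposition (F := fun w (y : X) => (f w : X) + y)) => //.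
  move=> x; apply: (measurable_superposition (F := fun _ (y : X) => y + x)) => //.
  by move=> w _ y; apply: cvgD; [exact: cvg_id|exact: cvg_cst].
by move=> w _ y; apply: cvgD; [exact: cvg_cst|exact: cvg_id].
Qed.

Lemma measurable_opp D f : measurable_fun D f ->
  measurable_fun D (fun w => - (f w : X) : borelX).
Proof.
move=> mf; apply: (measurable_superposition (F := fun _ (y : X) => - y)) => //.
by move=> w _ y; apply: cvgN; exact: cvg_id.
Qed.

Lemma measurable_series_sum (r : Omega -> R) D (u : Omega -> nat -> X) :
  (forall w, D w -> 0 <= r w < 1) ->
  (forall k, measurable_fun D (fun w => u w k : borelX)) ->
  (forall w, D w -> geo_dominated (r w) (u w)) ->
  measurable_fun D (fun w => series_sum (u w) : borelX).
Proof.
move=> r01 mu gu.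
apply: (measurable_limit (f_ := fun n w => series (u w) n)) => [n|w Dw].
  elim: n => [|n IH].
    rewrite (_ : (fun _ => _) = cst 0) //.
    by apply/funext => w; rewrite /series /= big_nil.
  rewrite (_ : (fun _ => _) = fun w => series (u w) n + u w n).
    exact: measurable_add.
  by apply/funext => w; rewrite /series /= big_nat_recr.
exact: (series_sum_cvg (r01 w Dw) (gu w Dw)).
Qed.

End SeparableMeasurability.

(** * Exponential dichotomies along a two-sided sequence of operators *)

(** [S k n] is the evolution from time [n] to time [n + k] on the stable space,
    [U k n] the inverse evolution from time [n] to time [n - k] on the unstable
    space, both composed with the projection at time [n]. *)
Record dichotomy_on_Z {R : realType} {X : normedModType R}
    (A : int -> X -> X) (S U : nat -> int -> X -> X) (K : int -> R) (a : R) :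
    Prop := {
  dz_A : forall n, bounded_operator (A n) ;
  dz_S : forall k n, bounded_operator (S k n) ;
  dz_U : forall k n, bounded_operator (U k n) ;
  dz_split : forall n x, S 0%N n x + U 0%N n x = x ;
  dz_AS : forall k n x, A (n + k%:Z) (S k n x) = S k.+1 n x ;
  dz_SA : forall k n x, S k (n + 1) (A n x) = S k.+1 n x ;
  dz_AU : forall k n x, A (n - k.+1%:Z) (U k.+1 n x) = U k n x ;
  dz_UA : forall k n x, U k.+1 (n + 1) (A n x) = U k n x ;
  dz_SS : forall k j n x, S k (n + j%:Z) (S j n x) = S (k + j)%N n x ;
  dz_US : forall k j n x, U k (n + j%:Z) (S j n x) = 0 ;
  dz_UU : forall k j n x, U k (n - j%:Z) (U j n x) = U (k + j)%N n x ;
  dz_SU : forall k j n x, S k (n - j%:Z) (U j n x) = 0 ;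
  dz_K : forall n, 0 < K n ;
  dz_boundS : forall k n x, `|S k n x| <= K n * a ^+ k * `|x| ;
  dz_boundU : forall k n x, `|U k n x| <= K n * a ^+ k * `|x|
}.

Lemma ler0_geometric {R : realType} (z M a : R) : 0 <= a < 1 ->
  (forall k, z <= M * a ^+ k) -> z <= 0.
Proof.
move=> /andP[a0 a1] zM.
have c : (fun k => M * a ^+ k) @ \oo --> (0 : R).
  by apply: cvg_geometric; rewrite ger0_norm.
by apply: (ler_cvg_to (cvg_cst z) c); near=> k; exact: zM.
Unshelve. all: by end_near. Qed.

Section Perturbation.
Context {R : realType} {X : completeNormedModType R}.
Variables (A : int -> X -> X) (S U : nat -> int -> X -> X) (K : int -> R).
Variables (a s : R).
Hypothesis dich : dichotomy_on_Z A S U K a.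
Hypotheses (a0 : 0 < a) (s1 : 1 <= s) (as1 : a * s < 1).
Implicit Types (x y h f : int -> X) (w : int -> R).

Let s0 : 0 < s. Proof. exact: lt_le_trans s1. Qed.
Let as01 : 0 <= a * s < 1. Proof. by rewrite as1 mulr_ge0 // ltW. Qed.
Let a01 : 0 <= a < 1.
Proof. by rewrite ltW //= (le_lt_trans _ as1) // ler_peMr // ltW. Qed.

(** Size of a sequence measured by the evolution on both halves of the dichotomy.
    It bounds the sequence itself and is finite as soon as [K n * |x n|] is bounded,
    but it involves no value of [K], and it controls homogeneous solutions along
    every orbit. *)
Definition adapted (M : R) x : Prop := forall n k,
  `|S k n (x n)| <= M * a ^+ k /\ `|U k n (x n)| <= M * a ^+ k.

Definition tame x : Prop := exists M, adapted M x.

Lemma tame_comb c x y : tame x -> tame y -> tame (fun n => c *: x n + y n).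
Proof.
move=> [M xM] [N yN]; exists (`|c| * M + N) => n k.
have [sx ux] := xM n k; have [sy uy] := yN n k.
have [[lS _] [lU _]] := (dz_S dich k n, dz_U dich k n).
rewrite lS lU mulrDl -mulrA.
by split; apply: le_trans (ler_normD _ _) _; apply: lerD => //;
  rewrite normrZ ler_wpM2l.
Qed.

Lemma tame_sub x y : tame x -> tame y -> tame (fun n => x n - y n).
Proof.
move=> tx ty; rewrite (_ : (fun _ => _) = fun n => -1 *: y n + x n).
  exact: tame_comb.
by apply/funext => n; rewrite scaleN1r addrC.
Qed.

Lemma tame_of_source M x : (forall n, K n * `|x n| <= M) -> tame x.
Proof.
move=> xM; exists M => n k; have ak : 0 <= a ^+ k by rewrite exprn_ge0 // ltW.
split; [apply: le_trans (dz_boundS dich k n _) _|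
  apply: le_trans (dz_boundU dich k n _) _];
  by rewrite mulrAC ler_wpM2r.
Qed.

Lemma adapted_bounded M x n : adapted M x -> `|x n| <= M + M.
Proof.
move=> xM; have [] := xM n 0%N; rewrite expr0 mulr1 => sx ux.
by rewrite -(dz_split dich n (x n)); apply: le_trans (ler_normD _ _) (lerD _ _).
Qed.

(** The stable part at time [n] comes from any earlier time [n - k] and the unstable
    part from any later time [n + k]; tameness makes both at most [M * a ^+ k]. *)
Lemma tame_homogeneous x : tame x -> (forall n, x (n + 1) = A n (x n)) ->
  forall n, x n = 0.
Proof.
move=> [M xM] xA n.
have Sx k : S 0%N n (x n) = S k (n - k%:Z) (x (n - k%:Z)).
  elim: k => [|k ->]; first by rewrite subr0.
  rewrite -(dz_SA dich) -xA.
  by rewrite (_ : n - k.+1%:Z + 1 = n - k%:Z); last by lia.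
have Ux k : U 0%N n (x n) = U k (n + k%:Z) (x (n + k%:Z)).
  elim: k => [|k ->]; first by rewrite addr0.
  rewrite (_ : n + k.+1%:Z = n + k%:Z + 1); last by lia.
  by rewrite xA (dz_UA dich).
rewrite -(dz_split dich n (x n)).
have -> : S 0%N n (x n) = 0.
  apply/eqP; rewrite -normr_le0; apply: (ler0_geometric (M := M) a01) => k.
  by rewrite (Sx k); have [] := xM (n - k%:Z) k.
have -> : U 0%N n (x n) = 0.
  apply/eqP; rewrite -normr_le0; apply: (ler0_geometric (M := M) a01) => k.
  by rewrite (Ux k); have [] := xM (n + k%:Z) k.
by rewrite addr0.
Qed.

(** [s ^- |n|] and the constant [1] are the two weights used below; the bounds on
    the ratios of consecutive values let a weight pass through the two series. *)
Definition weight w : Prop := forall n,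
  [/\ 0 <= w n <= 1, w (n - 1) <= s * w n & w (n + 1) <= s * w n].

(** The shift by one in the weight makes [feedback] send a sequence of weight [w] to
    a source of the same weight. *)
Definition source (M : R) w h : Prop := forall n, K n * `|h n| <= M * w (n - 1).

Lemma weight1 : weight (fun=> 1).
Proof. by move=> n; rewrite ler01 lexx !mulr1. Qed.

Lemma weight_past w n k : weight w -> w (n - k%:Z) <= s ^+ k * w n.
Proof.
move=> ww; elim: k => [|k IH]; first by rewrite subr0 expr0 mul1r.
have [_ h _] := ww (n - k%:Z).
rewrite (_ : n - k.+1%:Z = n - k%:Z - 1); last by lia.
by apply: le_trans h _; rewrite exprS -mulrA ler_wpM2l // ltW.
Qed.

Lemma weight_future w n k : weight w -> w (n + k%:Z) <= s ^+ k * w n.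
Proof.
move=> ww; elim: k => [|k IH]; first by rewrite addr0 expr0 mul1r.
have [_ _ h] := ww (n + k%:Z).
rewrite (_ : n + k.+1%:Z = n + k%:Z + 1); last by lia.
by apply: le_trans h _; rewrite exprS -mulrA ler_wpM2l // ltW.
Qed.

Definition stable_term h n k : X := S k (n - k%:Z) (h (n - k%:Z)).
Definition unstable_term h n k : X := U k.+1 (n + k.+1%:Z) (h (n + k.+1%:Z)).

(** Variation of constants: the past sources are transported forward on the stable
    side, the future ones backward on the unstable side. *)
Definition response h n : X := series_sum (stable_term h n) - series_sum (unstable_term h n).

Section Source.
Variables (M : R) (w : int -> R) (h : int -> X).
Hypotheses (M0 : 0 <= M) (ww : weight w) (hs : source M w h).

Let source_le n : K n * `|h n| <= M.
Proof.
apply: le_trans (hs n) _; have [/andP[_ w1] _ _] := ww (n - 1).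
by rewrite -[leRHS]mulr1 ler_wpM2l.
Qed.

Lemma stable_term_bound n k :
  `|stable_term h n k| <= M * s * w n * (a * s) ^+ k.
Proof.
apply: le_trans (dz_boundS dich _ _ _) _; rewrite mulrAC.
have ak : 0 <= a ^+ k by rewrite exprn_ge0 // ltW.
apply: le_trans (ler_wpM2r ak (hs _)) _.
have := weight_past n k.+1 ww.
rewrite (_ : n - k.+1%:Z = n - k%:Z - 1); last by lia.
move=> /(ler_wpM2l M0) /(ler_wpM2r ak) /le_trans; apply.
by rewrite exprS exprMn le_eqVlt; apply/orP; left; apply/eqP; ring.
Qed.

Lemma unstable_term_bound n k :
  `|unstable_term h n k| <= M * a * w n * (a * s) ^+ k.
Proof.
apply: le_trans (dz_boundU dich _ _ _) _; rewrite mulrAC.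
have ak : 0 <= a ^+ k.+1 by rewrite exprn_ge0 // ltW.
apply: le_trans (ler_wpM2r ak (hs _)) _.
have := weight_future n k ww.
rewrite (_ : n + k%:Z = n + k.+1%:Z - 1); last by lia.
move=> /(ler_wpM2l M0) /(ler_wpM2r ak) /le_trans; apply.
by rewrite exprS exprMn le_eqVlt; apply/orP; left; apply/eqP; ring.
Qed.

Lemma stable_geo n : geo_dominated (a * s) (stable_term h n).
Proof. by exists (M * s * w n); exact: stable_term_bound. Qed.

Lemma unstable_geo n : geo_dominated (a * s) (unstable_term h n).
Proof. by exists (M * a * w n); exact: unstable_term_bound. Qed.

Lemma response_bound n : `|response h n| <= M * ((s + a) / (1 - a * s)) * w n.
Proof.
apply: le_trans (ler_normB _ _) _.
apply: le_trans (lerD (series_sum_bound as01 (stable_term_bound n))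
                      (series_sum_bound as01 (unstable_term_bound n))) _.
by rewrite le_eqVlt; apply/orP; left; apply/eqP; ring.
Qed.

(** Consecutive values share all terms of the two series except the one at lag
    zero, which the splitting of the identity reassembles into [h]. *)
Lemma response_solves n : response h (n + 1) = A n (response h n) + h (n + 1).
Proof.
have AS : (A n) (series_sum (stable_term h n)) =
    series_sum (stable_term h (n + 1)) - S 0%N (n + 1) (h (n + 1)).
  rewrite (series_sum_operator as01 (dz_A dich n) (stable_geo n)).
  rewrite (series_sum_recl as01 (stable_geo (n + 1))) [stable_term h (n + 1) 0%N]/stable_term.
  rewrite subr0 [S 0%N _ _ + _]addrC addrK; congr series_sum.
  apply/funext => k /=; rewrite /stable_term -[in A n](subrK k%:Z n) (dz_AS dich).
  by rewrite (_ : n + 1 - k.+1%:Z = n - k%:Z); last by lia.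
have AU : (A n) (series_sum (unstable_term h n)) =
    U 0%N (n + 1) (h (n + 1)) + series_sum (unstable_term h (n + 1)).
  rewrite (series_sum_operator as01 (dz_A dich n) (unstable_geo n)).
  have := geo_dominated_operator (dz_A dich n) (unstable_geo n).
  have -> : A n \o unstable_term h n =
      fun k => U k (n + k.+1%:Z) (h (n + k.+1%:Z)).
    apply/funext => k /=; rewrite /unstable_term -[RHS](dz_AU dich).
    by rewrite (_ : n + k.+1%:Z - k.+1%:Z = n); last by lia.
  move=> gU; rewrite (series_sum_recl as01 gU); congr (_ + series_sum _).
  apply/funext => k; rewrite /unstable_term.
  by rewrite (_ : n + k.+2%:Z = n + 1 + k.+1%:Z); last by lia.
rewrite /response (bounded_operator_sub (dz_A dich n)) AS AU.
have := dz_split dich (n + 1) (h (n + 1)).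
set S0 := S _ _ _; set U0 := U _ _ _; set hh := h _ => <-.
set u := series_sum _; set v := series_sum _.
have -> : u - S0 - (U0 + v) = u - v - (S0 + U0).
  by rewrite -!addrA -!opprD addrA [v + _]addrC.
by rewrite subrK.
Qed.

(** Evolving the response further cancels one of the two series and turns the lag
    [j] of the other into [k + j], which produces the factor [a ^+ k]. *)
Lemma response_adapted : adapted (M / (1 - a)) (response h).
Proof.
move=> n k; have a1 : 0 < 1 - a by rewrite subr_gt0; have /andP[] := a01.
have ai j : 0 <= a ^+ j by rewrite exprn_ge0 // ltW.
have z0 : series_sum (fun _ : nat => 0 : X) = 0.
  apply/eqP; rewrite -normr_le0 -(mul0r (1 - a)^-1).
  by apply: (series_sum_bound a01) => j; rewrite normr0 mul0r.
have nS j : n = n - j%:Z + j%:Z by rewrite subrK.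
have nU j : n = n + j%:Z - j%:Z by rewrite addrK.
split.
  rewrite (bounded_operator_sub (dz_S dich k n)).
  rewrite (series_sum_operator as01 (dz_S dich k n) (stable_geo n)).
  rewrite (series_sum_operator as01 (dz_S dich k n) (unstable_geo n)).
  have -> : series_sum (S k n \o unstable_term h n) = 0.
    rewrite -[RHS]z0; congr series_sum; apply/funext => j /=.
    by rewrite {1}(nU j.+1) (dz_SU dich).
  rewrite subr0 mulrAC; apply: (series_sum_bound a01) => j /=.
  rewrite {1}(nS j) (dz_SS dich).
  apply: le_trans (dz_boundS dich _ _ _) _.
  by rewrite mulrAC -[leRHS]mulrA -exprD ler_wpM2r.
rewrite (bounded_operator_sub (dz_U dich k n)).
rewrite (series_sum_operator as01 (dz_U dich k n) (stable_geo n)).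
rewrite (series_sum_operator as01 (dz_U dich k n) (unstable_geo n)).
have -> : series_sum (U k n \o stable_term h n) = 0.
  rewrite -[RHS]z0; congr series_sum; apply/funext => j /=.
  by rewrite {1}(nS j) (dz_US dich).
rewrite sub0r normrN mulrAC; apply: (series_sum_bound a01) => j /=.
rewrite {1}(nU j.+1) (dz_UU dich).
apply: le_trans (dz_boundU dich _ _ _) _.
rewrite mulrAC -[leRHS]mulrA -exprD; apply: ler_pM => //.
  by rewrite mulr_ge0 // ltW // (dz_K dich).
by have /andP[_ /ltW a1'] := a01; apply: ler_wiXn2l; [exact: ltW| |rewrite leq_add2l].
Qed.

End Source.

Section Perturbed.
Variables (B : int -> X -> X) (rho : R).
Hypothesis bB : forall n, bounded_operator (B n).
Hypothesis rho0 : 0 <= rho.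
Hypothesis AB : forall (n : int) u, K (n + 1) * `|B n u - A n u| <= rho * `|u|.

(** A Lipschitz constant of [x |-> response (feedback x)] for a weighted supremum
    norm. *)
Definition ratio : R := rho * ((s + a) / (1 - a * s)).
Hypothesis q1 : ratio < 1.

Let sa0 : 0 <= (s + a) / (1 - a * s).
Proof.
by apply: divr_ge0; [rewrite addr_ge0 // ltW|rewrite subr_ge0 ltW].
Qed.
Let q01 : 0 <= ratio < 1.
Proof. by rewrite q1 andbT mulr_ge0. Qed.

(** The perturbed equation is the original one with the source [feedback x]
    added. *)
Definition feedback x n : X := B (n - 1) (x (n - 1)) - A (n - 1) (x (n - 1)).

Lemma feedbackS x n : feedback x (n + 1) = B n (x n) - A n (x n).
Proof. by rewrite /feedback addrK. Qed.

Lemma feedback_source N w x : (forall n, `|x n| <= N * w n) ->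
  source (rho * N) w (feedback x).
Proof.
move=> xN n; have := AB (n - 1) (x (n - 1)); rewrite subrK => /le_trans; apply.
by rewrite -mulrA ler_wpM2l.
Qed.

Definition is_solution f x : Prop :=
  tame x /\ forall n, x (n + 1) = B n (x n) + f (n + 1).

(** By uniqueness for the original equation, a tame homogeneous solution is the
    response to its own feedback; iterating, it is bounded by all powers of the
    ratio. *)
Lemma homogeneous_solution x : is_solution (fun=> 0) x -> forall n, x n = 0.
Proof.
move=> [[M xM] xB] n; have tx : tame x by exists M.
have N0 : 0 <= M + M by exact: le_trans (normr_ge0 _) (adapted_bounded 0 xM).
suff xq j m : `|x m| <= (M + M) * ratio ^+ j.
  by apply/eqP; rewrite -normr_le0; apply: (ler0_geometric q01).
elim: j m => [|j IH] m; first by rewrite expr0 mulr1; exact: adapted_bounded.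
set N := (M + M) * ratio ^+ j.
have N1 : 0 <= N by rewrite mulr_ge0 // exprn_ge0 //; have /andP[] := q01.
have fs : source (rho * N) (fun=> 1) (feedback x).
  by apply: feedback_source => k; rewrite mulr1; exact: IH.
have rN : 0 <= rho * N by rewrite mulr_ge0.
have xg k : x k = response (feedback x) k.
  apply/eqP; rewrite -subr_eq0; apply/eqP.
  apply: (tame_homogeneous (x := fun k => x k - response (feedback x) k)).
    apply: tame_sub => //; exists (rho * N / (1 - a)).
    exact: response_adapted weight1 fs.
  move=> i; rewrite (response_solves rN weight1 fs) xB addr0 feedbackS.
  set g := response _ i.
  rewrite (bounded_operator_sub (dz_A dich i) (x i) g) opprD opprB.
  by rewrite addrCA [B i (x i) + _]addrC subrK addrC.
rewrite xg; apply: le_trans (response_bound rN weight1 fs m) _.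
by rewrite /N exprSr /ratio le_eqVlt; apply/orP; left; apply/eqP; ring.
Qed.

Lemma solution_comb c f g x y : is_solution f x -> is_solution g y ->
  is_solution (fun n => c *: f n + g n) (fun n => c *: x n + y n).
Proof.
move=> [tx xf] [ty yg]; split; first exact: tame_comb.
move=> n; have [lB _] := bB n.
by rewrite lB xf yg scalerDr addrACA.
Qed.

Lemma solution_unique f x y : is_solution f x -> is_solution f y ->
  forall n, x n = y n.
Proof.
move=> sx sy n; have := solution_comb (-1) sx sy.
rewrite (_ : (fun n => -1 *: f n + f n) = fun=> 0); last first.
  by apply/funext => k; rewrite scaleN1r addNr.
move=> /homogeneous_solution /(_ n)/eqP.
by rewrite scaleN1r addrC subr_eq0 => /eqP.
Qed.

(** The successive sources of the Neumann series for the perturbed equation. *)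
Fixpoint picard f j : int -> X :=
  if j is i.+1 then feedback (response (picard f i)) else f.

Definition solve f n : X := series_sum (fun j => response (picard f j) n).

Section Solve.
Variables (M : R) (w : int -> R) (f : int -> X).
Hypotheses (M0 : 0 <= M) (ww : weight w) (fs : source M w f).

Let Mq0 j : 0 <= M * ratio ^+ j.
Proof. by rewrite mulr_ge0 // exprn_ge0 //; have /andP[] := q01. Qed.

Lemma picard_source j : source (M * ratio ^+ j) w (picard f j).
Proof.
elim: j => [|j IH]; first by rewrite expr0 mulr1.
rewrite exprSr (_ : M * _ = rho * (M * ratio ^+ j * ((s + a) / (1 - a * s)))).
  by apply: feedback_source => n; exact: response_bound.
by rewrite /ratio; ring.
Qed.

Lemma solve_term_bound n j :
  `|response (picard f j) n| <= M * ((s + a) / (1 - a * s)) * w n * ratio ^+ j.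
Proof.
apply: le_trans (response_bound (Mq0 j) ww (picard_source j) n) _.
by rewrite le_eqVlt; apply/orP; left; apply/eqP; ring.
Qed.

Lemma solve_geo n : geo_dominated ratio (fun j => response (picard f j) n).
Proof. by eexists; exact: solve_term_bound. Qed.

Lemma solve_bound n :
  `|solve f n| <= M * ((s + a) / (1 - a * s) / (1 - ratio)) * w n.
Proof.
apply: le_trans (series_sum_bound q01 (solve_term_bound n)) _.
by rewrite le_eqVlt; apply/orP; left; apply/eqP; ring.
Qed.

(** Each term of the Neumann series is driven by the feedback of the preceding one,
    so the feedbacks telescope against the difference of [B] and [A]. *)
Lemma solve_is_solution : is_solution f (solve f).
Proof.
split.
  exists (M / (1 - a) / (1 - ratio)) => n k.
  have ad j := response_adapted (Mq0 j) ww (picard_source j).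
  split.
    rewrite /solve (series_sum_operator q01 (dz_S dich k n) (solve_geo n)) mulrAC.
    apply: (series_sum_bound q01) => j /=; have [h _] := ad j n k.
    by apply: le_trans h _; rewrite le_eqVlt; apply/orP; left; apply/eqP; ring.
  rewrite /solve (series_sum_operator q01 (dz_U dich k n) (solve_geo n)) mulrAC.
  apply: (series_sum_bound q01) => j /=; have [_ h] := ad j n k.
  by apply: le_trans h _; rewrite le_eqVlt; apply/orP; left; apply/eqP; ring.
move=> n; rewrite /solve.
have bBA : bounded_operator (B n \- A n).
  by apply: bounded_operatorB => //; exact: dz_A dich n.
have g0 := solve_geo n; have g1 := solve_geo (n + 1).
rewrite (series_sum_recl q01 g1) /= (response_solves M0 ww fs).
have gA := geo_dominated_operator (dz_A dich n) g0.
have gD := geo_dominated_operator bBA g0.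
have -> : series_sum (fun k => response (feedback (response (picard f k))) (n + 1)) =
    series_sum (fun k => A n (response (picard f k.+1) n)) +
    series_sum (fun k => (B n \- A n) (response (picard f k) n)).
  rewrite -(series_sumD q01 (geo_dominatedS gA) gD).
  congr series_sum; apply/funext => k.
  have := response_solves (Mq0 k.+1) ww (picard_source k.+1) n => /= ->.
  by rewrite feedbackS.
have -> : B n (series_sum (fun j => response (picard f j) n)) =
    A n (series_sum (fun j => response (picard f j) n)) +
    (B n \- A n) (series_sum (fun j => response (picard f j) n)) by rewrite /= addrC subrK.
rewrite (series_sum_operator q01 (dz_A dich n) g0) (series_sum_operator q01 bBA g0).
rewrite (series_sum_recl q01 gA) /=.
by rewrite -!addrA; congr (_ + _); rewrite addrC -addrA.
Qed.

End Solve.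

Definition point_source (m : int) (v : X) n : X := if n == m then v else 0.

(** The columns of the Green function of the perturbed equation. *)
Definition green m v : int -> X := solve (point_source m v).

Lemma point_source_bound w m v : weight w -> w m = 1 ->
  source (K m * `|v| * s) w (point_source m v).
Proof.
move=> ww wm n; rewrite /point_source; case: eqP => [->|_].
  rewrite -mulrA -{1}[K m * `|v|]mulr1 ler_wpM2l ?mulr_ge0 ?(ltW (dz_K dich _)) //.
  by have [_ _] := ww (m - 1); rewrite subrK wm.
have [/andP[w0 _] _ _] := ww (n - 1).
by rewrite normr0 mulr0 !mulr_ge0 ?(ltW (dz_K dich _)) // ltW.
Qed.

Let Kvs0 m (v : X) : 0 <= K m * `|v| * s.
Proof. by rewrite !mulr_ge0 ?(ltW (dz_K dich _)) // ltW. Qed.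

Lemma green_solution m v : is_solution (point_source m v) (green m v).
Proof.
exact: solve_is_solution (Kvs0 m v) weight1 (point_source_bound v weight1 erefl).
Qed.

Lemma green_bound w m v n : weight w -> w m = 1 ->
  `|green m v n|
    <= K m * `|v| * s * ((s + a) / (1 - a * s) / (1 - ratio)) * w n.
Proof.
move=> ww wm.
exact: solve_bound (Kvs0 m v) ww (point_source_bound v ww wm) n.
Qed.

Lemma tame_point_source m v : tame (point_source m v).
Proof.
apply: (tame_of_source (M := K m * `|v|)) => n; rewrite /point_source.
by case: eqP => [->//|_]; rewrite normr0 mulr0 mulr_ge0 // ltW // (dz_K dich).
Qed.

Lemma green_linear m c v v' n :
  green m (c *: v + v') n = c *: green m v n + green m v' n.
Proof.
have := solution_comb c (green_solution m v) (green_solution m v').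
rewrite (_ : (fun n => c *: point_source m v n + _) =
             point_source m (c *: v + v')) => [h|].
  exact: solution_unique (green_solution m _) h n.
by apply/funext => k; rewrite /point_source; case: eqP => // _; rewrite scaler0 addr0.
Qed.

(** Cutting the solution at time [m] leaves a solution whose source is its value
    there; this is why the value of the Green function on the diagonal is a
    projection. *)
Lemma green_truncate m v n :
  green m (green m v m) n = if m <= n then green m v n else 0.
Proof.
have [[M gM] gB] := green_solution m v.
suff h : is_solution (point_source m (green m v m))
    (fun k => if m <= k then green m v k else 0).
  exact: solution_unique (green_solution m _) h n.
split.
  have M0 : 0 <= M.
    have [h _] := gM 0 0%N; rewrite expr0 mulr1 in h; exact: le_trans h.
  exists M => i k; case: ifP => // _.
  rewrite (bounded_operator0 (dz_S dich k i)) (bounded_operator0 (dz_U dich k i)).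
  by rewrite normr0 mulr_ge0 // exprn_ge0 // ltW.
move=> k; rewrite /point_source; case: eqP => [km|km].
  rewrite km lexx ifF ?(bounded_operator0 (bB k)) ?add0r //.
  by apply/negbTE; rewrite -ltNge; lia.
have -> : (m <= k + 1) = (m <= k) by lia.
case: ifP => _; last by rewrite (bounded_operator0 (bB k)) addr0.
by rewrite gB /point_source; case: eqP.
Qed.

(** Moving the source [v] one step forward along [B] only removes the jump of the
    solution at time [m]. *)
Lemma green_step m v n :
  green (m + 1) (B m v) n = green m v n - point_source m v n.
Proof.
have [gt gB] := green_solution m v.
suff h : is_solution (point_source (m + 1) (B m v))
    (fun k => green m v k - point_source m v k).
  exact: solution_unique (green_solution (m + 1) _) h n.
split; first by apply: tame_sub => //; exact: tame_point_source.
move=> k; rewrite gB addrK (bounded_operator_sub (bB k)).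
rewrite /point_source (inj_eq (addIr 1)).
by case: eqP => [->|_]; rewrite ?subrK // (bounded_operator0 (bB k)) subr0 addr0.
Qed.

End Perturbed.

(** The difference of the two Green functions solves the first equation with the
    source obtained by applying the difference of the operators to the second
    Green function. *)
Lemma green_perturbation (B B' : int -> X -> X) (rho eta : R) m v :
  (forall n, bounded_operator (B n)) -> (forall n, bounded_operator (B' n)) ->
  0 <= rho -> 0 <= eta -> ratio rho < 1 ->
  (forall (n : int) u, K (n + 1) * `|B n u - A n u| <= rho * `|u|) ->
  (forall (n : int) u, K (n + 1) * `|B' n u - A n u| <= rho * `|u|) ->
  (forall (n : int) u, K (n + 1) * `|B n u - B' n u| <= eta * `|u|) ->
  let C := (s + a) / (1 - a * s) / (1 - ratio rho) in
  forall n, `|green B m v n - green B' m v n| <= eta * (K m * `|v| * s * C) * C.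
Proof.
move=> bB bB' rho0 eta0 q1 AB AB' BB' C n.
have [gt gB] := green_solution bB rho0 AB q1 m v.
have [gt' gB'] := green_solution bB' rho0 AB' q1 m v.
pose f k := B (k - 1) (green B' m v (k - 1)) - B' (k - 1) (green B' m v (k - 1)).
have C0 : 0 <= C.
  apply: divr_ge0; last by rewrite subr_ge0 ltW.
  by apply: divr_ge0; [rewrite addr_ge0 // ltW|rewrite subr_ge0 ltW].
pose N := K m * `|v| * s * C.
have N0 : 0 <= N.
  apply: mulr_ge0 C0; apply: mulr_ge0 (ltW s0).
  by rewrite mulr_ge0 // ltW // (dz_K dich).
have fs : source (eta * N) (fun=> 1) f.
  move=> k; have := BB' (k - 1) (green B' m v (k - 1)); rewrite subrK.
  move=> /le_trans; apply; rewrite mulr1 ler_wpM2l //.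
  have := green_bound rho0 AB' q1 v (k - 1) weight1 (erefl : _ m = 1).
  by rewrite mulr1.
have eN : 0 <= eta * N by rewrite mulr_ge0.
have sf := solve_is_solution bB rho0 AB q1 eN weight1 fs.
rewrite (_ : green B m v n - _ = solve B f n); last first.
  apply: (solution_unique bB rho0 AB q1 (x := fun n => green B m v n - green B' m v n) _ sf n).
  split; first exact: tame_sub.
  move=> k; rewrite gB gB' /f addrK (bounded_operator_sub (bB k)).
  by rewrite opprD addrACA subrr addr0 addrA subrK.
by apply: le_trans (solve_bound rho0 AB q1 eN weight1 fs n) _; rewrite mulr1.
Qed.

End Perturbation.

(** * Cocycles along two-sided orbits *)

Section Orbits.
Context {d : measure_display} {Omega : measurableType d}.
Variables (theta thetaV : Omega -> Omega).
Hypotheses (thK : cancel theta thetaV) (thVK : cancel thetaV theta).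

Definition orbit (n : int) (w : Omega) : Omega :=
  match n with
  | Posz k => iter k theta w
  | Negz k => iter k.+1 thetaV w
  end.

Lemma orbitS n w : orbit (n + 1) w = theta (orbit n w).
Proof.
case: n => [k|[|k]].
- by rewrite (_ : Posz k + 1 = Posz k.+1) //; lia.
- by rewrite (_ : Negz 0 + 1 = Posz 0) //= thVK.
- rewrite (_ : Negz k.+1 + 1 = Negz k); last by lia.
  by rewrite /= thVK.
Qed.

Lemma orbit_theta n w : orbit n (theta w) = orbit (n + 1) w.
Proof.
rewrite orbitS; case: n => k /=; first by rewrite -iterSr.
by rewrite -iterS iterSr thK /= thVK.
Qed.

Lemma iter_orbit k n w : iter k theta (orbit n w) = orbit (n + k%:Z) w.
Proof.
elim: k => [|k IH]; first by rewrite addr0.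
rewrite /= IH -orbitS; congr orbit; lia.
Qed.

Lemma iterV_orbit k n w : iter k thetaV (orbit n w) = orbit (n - k%:Z) w.
Proof.
elim: k => [|k IH]; first by rewrite subr0.
rewrite /= IH (_ : n - k%:Z = n - k.+1%:Z + 1); last by lia.
by rewrite orbitS thK.
Qed.

Lemma orbitN k w : orbit (- k%:Z) w = iter k thetaV w.
Proof. by rewrite -[w in RHS]/(orbit 0 w) iterV_orbit sub0r. Qed.

Lemma iterK k w : iter k theta (iter k thetaV w) = w.
Proof. by rewrite -orbitN iter_orbit addNr. Qed.

Lemma iterVK k w : iter k thetaV (iter k theta w) = w.
Proof. by rewrite -[iter k theta w]/(orbit k%:Z w) iterV_orbit subrr. Qed.

Lemma orbit_invariant (T : Type) (g : Omega -> T) n w :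
  (forall v, g (theta v) = g v) -> g (orbit n w) = g w.
Proof.
move=> gth; case: n => k; rewrite /orbit.
  by elim: k => //= k IH; rewrite gth.
by elim: k.+1 => //= j IH; rewrite -IH -[LHS]gth thVK.
Qed.

Variable W : set Omega.
Hypothesis thW : theta @` W = W.

Lemma orbit_in n w : W w -> W (orbit n w).
Proof.
move=> Ww.
have Wth v : W v -> W (theta v) by move=> Wv; rewrite -thW; exists v.
have WthV v : W v -> W (thetaV v).
  by rewrite -{1}thW => -[u Wu <-]; rewrite thK.
case: n => k; rewrite /orbit; first by elim: k => //= k; exact: Wth.
by elim: k.+1 => //= j; exact: WthV.
Qed.

Lemma measurable_orbit n : measurable_fun setT theta ->
  measurable_fun setT thetaV -> measurable_fun setT (orbit n).
Proof.
move=> mt mtV; case: n => k; rewrite /orbit.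
  elim: k => [|k IH]; first exact: measurable_id.
  exact: (measurableT_comp mt IH).
elim: k.+1 => [|j IH]; first exact: measurable_id.
exact: (measurableT_comp mtV IH).
Qed.

Lemma measurable_along_orbit d' (T : measurableType d') (f : Omega -> T) n :
  measurable W -> measurable_fun setT theta -> measurable_fun setT thetaV ->
  measurable_fun W f -> measurable_fun W (fun w => f (orbit n w)).
Proof.
move=> mW mt mtV mf; apply: (measurable_comp (F := W) mW _ mf).
  by move=> _ [w Ww <-]; exact: orbit_in.
by apply: measurable_funTS; exact: measurable_orbit.
Qed.

End Orbits.

Section CocycleOperators.
Context {R : realType} {X : normedModType R}.
Context {d : measure_display} {Omega : measurableType d}.
Variables (theta thetaV : Omega -> Omega).
Hypotheses (thK : cancel theta thetaV) (thVK : cancel thetaV theta).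
Variables (Phi : nat -> Omega -> X -> X) (Pis : Omega -> X -> X).
Hypothesis cPhi : measurable_linear_cocycle theta Phi.

Lemma cocycle_bounded n w : bounded_operator (Phi n w).
Proof. by have [] := cPhi. Qed.

Lemma cocycle0 w x : Phi 0%N w x = x.
Proof. by have [_ -> ] := cPhi. Qed.

Lemma cocycleD n m w x : Phi (n + m)%N w x = Phi m (iter n theta w) (Phi n w x).
Proof. by have [_ _ ->] := cPhi. Qed.

Lemma cocycleS n w x : Phi n.+1 w x = Phi 1%N (iter n theta w) (Phi n w x).
Proof. by rewrite -addn1 cocycleD. Qed.

Lemma cocycleSr n w x : Phi n.+1 w x = Phi n (theta w) (Phi 1%N w x).
Proof. by rewrite -add1n cocycleD. Qed.

Definition stable_op k w : X -> X := Phi k w \o Pis w.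
Definition unstable_op k w : X -> X :=
  cocycle_neg thetaV Phi Pis k w \o compl_proj Pis w.

Lemma range_compl_proj w y : projection (Pis w) ->
  range (compl_proj Pis w) y <-> Pis w y = 0.
Proof.
move=> [bP PP]; split => [[x _ <-]|Py].
  rewrite /compl_proj (bounded_operator_sub bP).
  by rewrite -[Pis w (Pis w x)]/((Pis w \o Pis w) x) PP subrr.
by exists y => //; rewrite /compl_proj Py subr0.
Qed.

Section Inverse.
Variables (k : nat) (w : Omega).
Let w' := iter k thetaV w.
Hypotheses (pw : projection (Pis w)) (pw' : projection (Pis w')).
Hypothesis iso : isomorphism_between (range (compl_proj Pis w'))
  (range (compl_proj Pis w)) (Phi k w').

(** The two equations characterize the vector, by injectivity on the unstable
    space; linearity and the cocycle identities for negative times follow from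
    this without unfolding the partial inverse. *)
Lemma unstable_op_spec x : Pis w' (unstable_op k w x) = 0 /\
  Phi k w' (unstable_op k w x) = x - Pis w x.
Proof.
have [[_ _ sur] _] := iso.
have ry : range (compl_proj Pis w) (compl_proj Pis w x) by exists x.
split; last by apply: (surjpK (fun=> 0) sur); rewrite inE.
apply/(range_compl_proj _ pw').
have sub := @surjpinv_image_sub _ _ (fun=> 0) _ _ _ sur.
by apply: (sub (unstable_op k w x)); exists (compl_proj Pis w x).
Qed.

Lemma unstable_op_unique x y : Pis w' y = 0 -> Phi k w' y = x - Pis w x ->
  unstable_op k w x = y.
Proof.
have [[_ inj _] _] := iso => Py Fy.
have [Pu Fu] := unstable_op_spec x.
by apply: inj; rewrite ?inE ?Fy //; apply/range_compl_proj.
Qed.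

Lemma unstable_op_bounded : bounded_operator (unstable_op k w).
Proof.
have [bP' _] := pw'; have [bP _] := pw; have bF := cocycle_bounded k w'.
split.
  move=> c x y; have [[Px Fx] [Py Fy]] := (unstable_op_spec x, unstable_op_spec y).
  have [lP' _] := bP'; have [lP _] := bP; have [lF _] := bF.
  apply: unstable_op_unique; first by rewrite lP' Px Py scaler0 addr0.
  by rewrite lF Fx Fy lP scalerBr opprD addrACA.
have [_ [M bM]] := iso.
have [_ [N bN]] := bounded_operatorB bounded_operator_id bP.
exists (`|M| * N) => x; have [Pu Fu] := unstable_op_spec x.
have /bM /le_trans : range (compl_proj Pis w') (unstable_op k w x).
  exact/range_compl_proj.
apply; rewrite Fu; apply: (@le_trans _ _ (`|M| * `|x - Pis w x|)).
  by rewrite ler_wpM2r // ler_norm.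
by rewrite -mulrA ler_wpM2l //; exact: bN.
Qed.

End Inverse.

End CocycleOperators.

Section DichotomyAlongOrbit.
Context {R : realType} {X : normedModType R}.
Context {d : measure_display} {Omega : measurableType d}.
Variables (P : {measure set Omega -> \bar R}) (theta thetaV : Omega -> Omega).
Hypotheses (thK : cancel theta thetaV) (thVK : cancel thetaV theta).
Variables (Phi : nat -> Omega -> X -> X) (W : set Omega) (alpha K : Omega -> R).
Variable Pis : Omega -> X -> X.
Hypothesis cPhi : measurable_linear_cocycle theta Phi.
Hypothesis ted : tempered_exponential_dichotomy P theta thetaV Phi W alpha K Pis.
Local Notation orb := (orbit theta thetaV).
Local Notation st := (stable_op Phi Pis).
Local Notation un := (unstable_op thetaV Phi Pis).

Lemma dichotomy_set_in n w : W w -> W (orb n w).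
Proof. by have [_ thW _] := ted_set ted; exact: orbit_in. Qed.

Let Wp k w : W w -> W (iter k thetaV w).
Proof. by move=> Ww; rewrite -(orbitN thK thVK); exact: dichotomy_set_in. Qed.

Let Wf k w : W w -> W (iter k theta w).
Proof. exact: (@dichotomy_set_in k%:Z). Qed.

Let bP w : W w -> bounded_operator (Pis w).
Proof. by move=> /(ted_projection ted)[]. Qed.

Let PP w x : W w -> Pis w (Pis w x) = Pis w x.
Proof.
move=> /(ted_projection ted)[_ idem].
by rewrite -[LHS]/((Pis w \o Pis w) x) idem.
Qed.

Let PF k w x : W w -> Pis (iter k theta w) (Phi k w x) = Phi k w (Pis w x).
Proof.
move=> Ww; rewrite -[LHS]/((Pis (iter k theta w) \o Phi k w) x).
by rewrite (ted_commute ted).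
Qed.

Let iso k w : W w -> isomorphism_between
  (range (compl_proj Pis (iter k thetaV w))) (range (compl_proj Pis w))
  (Phi k (iter k thetaV w)).
Proof.
by move=> Ww; have := ted_isomorphism ted k (Wp k Ww); rewrite (iterK thK thVK).
Qed.

Let un_spec k w x (Ww : W w) := unstable_op_spec
  (ted_projection ted (Wp k Ww)) (iso k Ww) x.

Let un_unique k w x y (Ww : W w) := @unstable_op_unique _ _ _ _ _ _ _ k w
  (ted_projection ted (Wp k Ww)) (iso k Ww) x y.

Lemma stable_op_bounded k w : W w -> bounded_operator (st k w).
Proof.
by move=> Ww; apply: bounded_operator_comp; [exact: cocycle_bounded cPhi _ _|exact: bP].
Qed.

Lemma unstable_op_bounded_in k w : W w -> bounded_operator (un k w).
Proof.
move=> Ww; exact: (unstable_op_bounded cPhi (ted_projection ted Ww)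
  (ted_projection ted (Wp k Ww)) (iso k Ww)).
Qed.

(** Each identity for negative times is proved by exhibiting the right-hand side as
    the vector characterized by [unstable_op_spec]. *)
Lemma dichotomy_along_orbit w : W w ->
  dichotomy_on_Z (fun n => Phi 1%N (orb n w)) (fun k n => st k (orb n w))
    (fun k n => un k (orb n w)) (fun n => K (orb n w)) (expR (- alpha w)).
Proof.
move=> Ww; have Wo n : W (orb n w) by exact: dichotomy_set_in.
have al n : alpha (orb n w) = alpha w.
  by have [_ inv] := ted_exponent ted; exact: orbit_invariant.
have bF k v := cocycle_bounded cPhi k v.
split => //.
- by move=> k n; exact: stable_op_bounded.
- by move=> k n; exact: unstable_op_bounded_in.
- move=> n x; rewrite (@un_unique 0%N _ x (x - Pis (orb n w) x) (Wo n)).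
  + by rewrite /stable_op /= (cocycle0 cPhi) addrC subrK.
  + by rewrite /= (bounded_operator_sub (bP _)) // PP // subrr.
  + by rewrite (cocycle0 cPhi).
- move=> k n x; rewrite /stable_op /= -(iter_orbit thVK) (cocycleS cPhi k) //.
- move=> k n x; rewrite /stable_op /= (orbitS thVK).
  by rewrite (@PF 1%N) // (cocycleSr cPhi k).
- move=> k n x; set v := orb n w; have [Pu Fu] := un_spec k.+1 x (Wo n).
  have e : orb (n - k.+1%:Z) w = iter k.+1 thetaV v by rewrite (iterV_orbit thK thVK).
  have te : theta (iter k.+1 thetaV v) = iter k thetaV v by rewrite /= thVK.
  rewrite e; apply/esym/(un_unique (Wo n)).
    rewrite -te (@PF 1%N _ _ (Wp k.+1 (Wo n))) Pu.
    exact: bounded_operator0.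
  by rewrite -te -(cocycleSr cPhi).
- move=> k n x; have [Pu Fu] := un_spec k x (Wo n).
  have W1 := Wo (n + 1); rewrite (orbitS thVK) in W1 *.
  apply: (un_unique W1); rewrite iterSr thK //.
  rewrite (cocycleS cPhi k) (iterK thK thVK) Fu.
  by rewrite (bounded_operator_sub (bF _ _)) (@PF 1%N).
- move=> k j n x; rewrite /stable_op /= -(iter_orbit thVK) PF // PP //.
  by rewrite -(cocycleD cPhi) addnC.
- move=> k j n x; rewrite -(iter_orbit thVK).
  apply: (un_unique (Wf j (Wo n))).
    by apply: bounded_operator0; exact: bP (Wp _ (Wf _ _)).
  rewrite (bounded_operator0 (bF _ _)) /stable_op /= PF // PP // subrr //.
- move=> k j n x; rewrite -(iterV_orbit thK thVK).
  have Wj := Wp j (Wo n).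
  have [Pu Fu] := un_spec j x (Wo n).
  have [Pv Fv] := un_spec k (un j (orb n w) x) Wj.
  have e : iter (k + j) thetaV (orb n w) = iter k thetaV (iter j thetaV (orb n w)).
    by rewrite iterD.
  apply/esym/(un_unique (Wo n)); rewrite e //.
  by rewrite (cocycleD cPhi) (iterK thK thVK) Fv Pu subr0.
- move=> k j n x; rewrite -(iterV_orbit thK thVK) /stable_op /=.
  have [-> _] := un_spec j x (Wo n); exact: bounded_operator0.
- by move=> n; have [[_ K0] _] := ted_bound ted; exact: K0.
- move=> k n x; apply: opnorm_apply_le; first exact: stable_op_bounded.
  by rewrite -expRM_natr -(al n); exact: (ted_stable ted).
- move=> k n x; apply: opnorm_apply_le; first exact: unstable_op_bounded_in.
  by rewrite -expRM_natr -(al n); exact: (ted_unstable ted).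
Qed.

End DichotomyAlongOrbit.

(** * From a Green function to a tempered exponential dichotomy *)

Section GreenDichotomy.
Context {R : realType} {X : completeNormedModType R}.
Context {d : measure_display} {Omega : measurableType d}.
Variables (P : {measure set Omega -> \bar R}) (theta thetaV : Omega -> Omega).
Hypotheses (thK : cancel theta thetaV) (thVK : cancel thetaV theta).
Variables (Psi : nat -> Omega -> X -> X) (W : set Omega) (alpha K : Omega -> R).
Hypothesis cPsi : measurable_linear_cocycle theta Psi.
Hypothesis sepX : separable X.
Hypothesis setW : invariant_full_measure_set P theta W.
Hypothesis alphaP : positive_random_variable alpha /\ invariant_fun theta alpha.
Hypothesis KP : positive_random_variable K /\ tempered P theta thetaV K.
Local Notation orb := (orbit theta thetaV).
Local Notation borelX := (g_sigma_algebraType (@open X)).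
Local Notation jump n v := (if n == 0 then v else 0).

(** [g w n v] stands for the value at time [n] of the solution along the orbit of [w]
    with source [v] at time zero. *)
Variable g : Omega -> int -> X -> X.
Hypothesis g_linear : forall w n, W w -> linear (g w n).
Hypothesis g_bound : forall w n v, W w ->
  `|g w n v| <= K w * expR (- alpha w) ^+ `|n|%N * `|v|.
Hypothesis g_compl_bound : forall w v, W w -> `|v - g w 0 v| <= K w * `|v|.
Hypothesis g_solves : forall w (n : int) v, W w ->
  g w (n + 1) v = Psi 1%N (orb n w) (g w n v) + jump (n + 1) v.
Hypothesis g_truncate : forall w n v, W w ->
  g w n (g w 0 v) = if 0 <= n then g w n v else 0.
Hypothesis g_step : forall w (n : int) v, W w ->
  g (theta w) (n - 1) (Psi 1%N w v) = g w n v - jump n v.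
Hypothesis g_measurable : forall n v,
  measurable_fun W (fun w => g w n v : borelX).

Let Pis w : X -> X := g w 0.

(** Values of the Green function at negative times, corrected by the jump at time
    zero: the inverse branch of the cocycle on the unstable space. *)
Definition green_branch k w v : X := jump k%:Z v - g w (- k%:Z) v.
Local Notation L := green_branch.

Let thW : theta @` W = W. Proof. by have [] := setW. Qed.

Let Wo n w : W w -> W (orb n w). Proof. exact: orbit_in. Qed.

Let Wp k w : W w -> W (iter k thetaV w).
Proof. by move=> Ww; rewrite -(orbitN thK thVK); exact: Wo. Qed.

Let Wf k w : W w -> W (iter k theta w). Proof. exact: (@Wo k%:Z). Qed.

Let g_bounded w n : W w -> bounded_operator (g w n).
Proof.
move=> Ww; split; first exact: g_linear.
by exists (K w * expR (- alpha w) ^+ `|n|%N) => v; exact: g_bound.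
Qed.

Lemma branch_bounded k w : W w -> bounded_operator (L k w).
Proof.
move=> Ww; apply: bounded_operatorB (g_bounded _ Ww).
case: eqP => _; first exact: bounded_operator_id.
split; first by move=> c x y; rewrite scaler0 addr0.
by exists 0 => x; rewrite normr0 mul0r.
Qed.

Let L0 w v : L 0%N w v = v - Pis w v.
Proof. by rewrite /green_branch oppr0. Qed.

Let LS k w v : L k.+1 w v = - g w (- k.+1%:Z) v.
Proof. by rewrite /green_branch sub0r. Qed.

Lemma branch_forward k w v : W w ->
  Psi 1%N (iter k.+1 thetaV w) (L k.+1 w v) = L k w v.
Proof.
move=> Ww; rewrite -(orbitN thK thVK k.+1) LS /green_branch.
rewrite (bounded_operatorN (cocycle_bounded cPsi _ _)).
have := g_solves (- k.+1%:Z) v Ww.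
rewrite (_ : - k.+1%:Z + 1 = - k%:Z); last by lia.
by move=> ->; rewrite oppr_eq0 opprD addrCA subrr addr0.
Qed.

Lemma branch_cocycle k w v : W w ->
  Psi k (iter k thetaV w) (L k w v) = v - Pis w v.
Proof.
move=> Ww; elim: k => [|k IH]; first by rewrite (cocycle0 cPsi) L0.
rewrite (cocycleSr cPsi k) branch_forward //.
by rewrite (_ : theta _ = iter k thetaV w) //= thVK.
Qed.

Lemma branch_backward k w v : W w -> L k.+1 (theta w) (Psi 1%N w v) = L k w v.
Proof.
move=> Ww; rewrite LS /green_branch.
rewrite (_ : - k.+1%:Z = - k%:Z - 1); last by lia.
by rewrite g_step // opprB oppr_eq0.
Qed.

Lemma branch_inverse k w v : W w ->
  L k (iter k theta w) (Psi k w v) = v - Pis w v.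
Proof.
move=> Ww; elim: k => [|k IH]; first by rewrite (cocycle0 cPsi) L0.
by rewrite (cocycleS cPsi k) /= branch_backward //; exact: Wf.
Qed.

Let Pis_idem w v : W w -> Pis w (Pis w v) = Pis w v.
Proof. by move=> Ww; rewrite /Pis g_truncate // lexx. Qed.

Lemma branch_stable k w v : W w -> L k w (Pis w v) = 0.
Proof.
move=> Ww; rewrite /green_branch g_truncate // oppr_ge0.
case: k => [|k]; first by rewrite lexx oppr0 subrr.
by rewrite subr0.
Qed.

(** The branch does not see the stable part of its argument, so its value [y] is
    recovered by going forward and back, which replaces [y] by [y - Pis y]. *)
Lemma branch_range k w v : W w -> Pis (iter k thetaV w) (L k w v) = 0.
Proof.
move=> Ww; have := branch_inverse k (L k w v) (Wp k Ww).
rewrite (iterK thK thVK) branch_cocycle //.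
rewrite (bounded_operator_sub (branch_bounded k Ww)) branch_stable // subr0.
move/eqP; rewrite -subr_eq0 opprB addrCA subrr addr0 => /eqP.
by [].
Qed.

Lemma green_forward k w v : W w -> Psi k w (Pis w v) = g w k%:Z v.
Proof.
move=> Ww; elim: k => [|k IH]; first exact: (cocycle0 cPsi).
rewrite (cocycleS cPsi k) IH (_ : k.+1%:Z = k%:Z + 1); last by lia.
by rewrite g_solves // ifF ?addr0 //; lia.
Qed.

Lemma green_commute k w v : W w ->
  Pis (iter k theta w) (Psi k w v) = Psi k w (Pis w v).
Proof.
move=> Ww; elim: k => [|k IH]; first by rewrite !(cocycle0 cPsi).
rewrite !(cocycleS cPsi k) -IH /= {1}/Pis.
have := g_step 1 (Psi k w v) (Wf k Ww); rewrite subrr => ->.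
by rewrite (_ : (1 : int) = 0 + 1) // g_solves ?subr0 ?addr0 //; exact: Wf.
Qed.

Lemma green_branch_bound k w v : W w ->
  `|L k w v| <= K w * expR (- alpha w) ^+ k * `|v|.
Proof.
move=> Ww; case: k => [|k].
  by rewrite L0 expr0 mulr1; exact: g_compl_bound.
by rewrite LS normrN; apply: le_trans (g_bound _ _ Ww) _.
Qed.

Lemma green_isomorphism k w : W w ->
  isomorphism_between (range (compl_proj Pis w))
    (range (compl_proj Pis (iter k theta w))) (Psi k w).
Proof.
move=> Ww; have Wk := Wf k Ww.
have pr v : W v -> projection (Pis v).
  move=> Wv; split; first exact: g_bounded.
  by apply/funext => x; exact: Pis_idem.
have rP v y Wv := range_compl_proj y (pr v Wv).
have LPsi x : Pis w x = 0 -> L k (iter k theta w) (Psi k w x) = x.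
  by move=> Px; rewrite branch_inverse // Px subr0.
split; last first.
  have [_ [M bM]] := branch_bounded k Wk; exists M => x /(rP _ _ Ww) Px.
  by rewrite -{1}(LPsi x Px).
split.
- move=> x /(rP _ _ Ww) Px; apply/(rP _ _ Wk).
  by rewrite green_commute // Px (bounded_operator0 (cocycle_bounded cPsi _ _)).
- move=> x y; rewrite !inE => /(rP _ _ Ww) Px /(rP _ _ Ww) Py e.
  by rewrite -(LPsi x Px) e LPsi.
- move=> y /(rP _ _ Wk) Py.
  have := branch_range k y Wk; rewrite (iterVK thK thVK) => PL.
  exists (L k (iter k theta w) y); first exact/(rP _ _ Ww).
  by have := branch_cocycle k y Wk; rewrite (iterVK thK thVK) Py subr0.
Qed.

Lemma green_cocycle_neg k w : W w ->
  cocycle_neg thetaV Psi Pis k w \o compl_proj Pis w = L k w.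
Proof.
move=> Ww; have Wk := Wp k Ww; apply/funext => v.
apply: (unstable_op_unique (Pis := Pis)).
- split; first exact: g_bounded.
  by apply/funext => x; exact: Pis_idem.
- by have := green_isomorphism k Wk; rewrite (iterK thK thVK).
- exact: branch_range.
- exact: branch_cocycle.
Qed.

Theorem green_dichotomy :
  tempered_exponential_dichotomy P theta thetaV Psi W alpha K Pis.
Proof.
have K0 w : 0 <= K w by have [[_ h] _] := KP; exact: ltW.
have e0 w k : 0 <= K w * expR (- alpha w) ^+ k.
  by rewrite mulr_ge0 // exprn_ge0 // expR_ge0.
split => //.
- by move=> v; exact: g_measurable.
- move=> w Ww; split; first exact: g_bounded.
  by apply/funext => x; exact: Pis_idem.
- by move=> w n Ww; apply/funext => x; exact: green_commute.
- by move=> w n; exact: green_isomorphism.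
- move=> k v.
  have mL : measurable_fun W (fun w => L k w v : borelX).
    apply: (measurable_add sepX (f := fun=> jump k%:Z v)); first exact: measurable_cst.
    exact: measurable_opp.
  apply: eq_measurable_fun mL => w; rewrite inE => Ww.
  by rewrite -green_cocycle_neg.
- move=> w n Ww; rewrite expRM_natr; apply: opnorm_le => // v /=.
  by rewrite green_forward //; exact: g_bound.
- move=> w n Ww; rewrite expRM_natr green_cocycle_neg //; apply: opnorm_le => // v.
  exact: green_branch_bound.
Qed.

End GreenDichotomy.

(** * Exponent and bound of the perturbed dichotomy *)

Section Constants.
Context {R : realType}.
Implicit Types a rho : R.

(** The midpoint between [1] and [(1 - rho * a) / (rho + a)], the value of [s] at
    which the contraction ratio reaches one. *)
Definition rate a rho : R := ((1 - rho * a) / (rho + a) + 1) / 2.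

Lemma rateP a rho : 0 < a < 1 -> 0 < rho -> rho < (1 - a) / (1 + a) ->
  [/\ 1 < rate a rho, a * rate a rho < 1 & ratio a (rate a rho) rho < 1].
Proof.
move=> /andP[a0 a1] r0.
rewrite ltr_pdivlMr ?addr_gt0 // => rlt.
have ra0 : 0 < rho + a by rewrite addr_gt0.
set t := (1 - rho * a) / (rho + a).
have tE : t * (rho + a) = 1 - rho * a by rewrite /t divfK // gt_eqF.
have t1 : 1 < t by rewrite ltr_pdivlMr // mul1r; lra.
have at1 : a * t < 1.
  by rewrite mulrA ltr_pdivrMr // mul1r; nra.
have sE : rate a rho = (t + 1) / 2 by [].
have as1 : a * rate a rho < 1 by rewrite sE; lra.
split => //; first by rewrite sE; lra.
rewrite /ratio mulrA ltr_pdivrMr ?subr_gt0 // mul1r.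
have : rate a rho * (rho + a) < t * (rho + a).
  by rewrite ltr_pM2r // sE; lra.
by rewrite tE mulrDr mulrDr; set q := rate a rho; lra.
Qed.

(** The factor of [K m * |v| * w n] in [green_bound]. *)
Definition green_constant a rho : R :=
  let s := rate a rho in
  s * ((s + a) / (1 - a * s) / (1 - ratio a s rho)).

Lemma green_constant_ge0 a rho : 0 < a < 1 -> 0 < rho ->
  rho < (1 - a) / (1 + a) -> 0 <= green_constant a rho.
Proof.
move=> a01 r0 rlt; have [s1 as1 q1] := rateP a01 r0 rlt.
have s0 : 0 <= rate a rho by rewrite ltW // (lt_trans _ s1).
apply: mulr_ge0 => //; apply: divr_ge0; last by rewrite subr_ge0 ltW.
apply: divr_ge0; last by rewrite subr_ge0 ltW.
by rewrite addr_ge0 // ltW //; have /andP[] := a01.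
Qed.

Lemma exp_weight (s : R) : 1 <= s -> weight s (fun n => s^-1 ^+ `|n|%N).
Proof.
move=> s1; have s0 : 0 < s by exact: lt_le_trans s1.
have v01 : 0 <= s^-1 <= 1 by rewrite invr_ge0 ltW //= invf_le1.
have [v0 v1] := andP v01.
have key (i j : nat) : (i <= j.+1)%N -> s^-1 ^+ j <= s * s^-1 ^+ i.
  move=> ij; have -> : s^-1 ^+ j = s * s^-1 ^+ j.+1.
    by rewrite exprS mulrA divff ?mul1r // gt_eqF.
  by rewrite ler_wpM2l ?(ltW s0) // ler_wiXn2l.
move=> n; split; [by rewrite exprn_ge0 //= exprn_ile1| |]; by apply: key; lia.
Qed.

End Constants.

Section MeasurableScalars.
Context {R : realType} {d : measure_display} {Omega : measurableType d}.
Implicit Types g : Omega -> R.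

Lemma measurable_inv_pos g : measurable_fun setT g -> (forall w, 0 < g w) ->
  measurable_fun setT (fun w => (g w)^-1).
Proof.
move=> mg g0; rewrite (_ : (fun _ => _) = fun w => expR (- ln (g w))).
  apply: measurableT_comp; first exact: measurable_expR.
  apply: measurable_funN; apply: (measurableT_comp _ mg); exact: measurable_ln.
by apply/funext => w; rewrite expRN lnK ?posrE.
Qed.

Variables (alpha rho : Omega -> R).
Hypotheses (malpha : measurable_fun setT alpha) (mrho : measurable_fun setT rho).
Hypotheses (alpha0 : forall w, 0 < alpha w) (rho0 : forall w, 0 < rho w).
Hypothesis rholt :
  forall w, rho w < (1 - expR (- alpha w)) / (1 + expR (- alpha w)).
Let a w := expR (- alpha w).

Let a01 w : 0 < a w < 1.
Proof. by rewrite /a expR_gt0 -[ltRHS]expR0 ltr_expR oppr_lt0 alpha0. Qed.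

Let ma : measurable_fun setT a.
Proof.
by apply: measurableT_comp; [exact: measurable_expR|exact: measurable_funN].
Qed.

Lemma measurable_rate : measurable_fun setT (fun w => rate (a w) (rho w)).
Proof.
apply: measurable_funM; last exact: measurable_cst.
apply: measurable_funD; last exact: measurable_cst.
apply: measurable_funM.
  apply: measurable_funB; first exact: measurable_cst.
  exact: measurable_funM.
apply: measurable_inv_pos; first exact: measurable_funD.
by move=> w; rewrite addr_gt0 // expR_gt0.
Qed.

Lemma measurable_green_constant :
  measurable_fun setT (fun w => green_constant (a w) (rho w)).
Proof.
have ms := measurable_rate.
have mi : measurable_fun setT (fun w => (1 - a w * rate (a w) (rho w))^-1).
  apply: measurable_inv_pos.
    apply: measurable_funB; [exact: measurable_cst|exact: measurable_funM].
  by move=> w; rewrite subr_gt0; have [] := rateP (a01 w) (rho0 w) (rholt w).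
have mc : measurable_fun setT
    (fun w => (rate (a w) (rho w) + a w) / (1 - a w * rate (a w) (rho w))).
  by apply: measurable_funM => //; exact: measurable_funD.
apply: measurable_funM => //; apply: measurable_funM => //.
apply: measurable_inv_pos.
  apply: measurable_funB; [exact: measurable_cst|exact: measurable_funM].
by move=> w; rewrite subr_gt0; have [] := rateP (a01 w) (rho0 w) (rholt w).
Qed.

End MeasurableScalars.

Lemma tempered_scale {R : realType} {d : measure_display}
    {Omega : measurableType d} (P : {measure set Omega -> \bar R})
    (theta thetaV : Omega -> Omega) (C K : Omega -> R) :
  cancel thetaV theta -> invariant_fun theta C ->
  (forall w, 0 < C w) -> (forall w, 0 < K w) ->
  tempered P theta thetaV K -> tempered P theta thetaV (fun w => C w * K w).
Proof.
move=> thVK invC C0 K0.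
have cn (c : R) : (fun n => c / n%:R) @ \oo --> (0 : R).
  have := cvgM (cvg_cst c) (@cvg_harmonic R); rewrite mulr0 => h.
  by rewrite -cvg_shiftS; exact: h.
have cnN (c : R) : (fun n => c / (- n%:R)) @ \oo --> (0 : R).
  rewrite (_ : (fun n => _) = fun n => - c / n%:R); first exact: cn.
  by apply/funext => n; rewrite invrN mulrN mulNr.
have Cf n w : C (iter n theta w) = C w by exact: (orbit_invariant thVK n%:Z).
have Cp n w : C (iter n thetaV w) = C w.
  by elim: n => //= n IH; rewrite -invC thVK.
apply: filterS => w [Kf Kp]; split.
  under eq_fun do rewrite Cf lnM ?posrE // mulrDl.
  by rewrite -[0](addr0 0); apply: cvgD.
under eq_fun do rewrite Cp lnM ?posrE // mulrDl.
by rewrite -[0](addr0 0); apply: cvgD.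
Qed.

Lemma opnorm_div_le {R : realType} {X : normedModType R} (T1 T2 : X -> X)
    (r k : R) : bounded_operator T1 -> bounded_operator T2 -> 0 < k ->
  opnorm (T1 \- T2) <= r / k -> forall u, k * `|T1 u - T2 u| <= r * `|u|.
Proof.
move=> b1 b2 k0 le u; rewrite mulrC -ler_pdivlMr // mulrAC.
exact: (opnorm_apply_le u (bounded_operatorB b1 b2) le).
Qed.

(** * The perturbed cocycle *)

Section Roughness.
Context {R : realType} {X : completeNormedModType R}.
Context {d : measure_display} {Omega : measurableType d}.
Variables (P : {measure set Omega -> \bar R}) (theta thetaV : Omega -> Omega).
Variables (Phi : nat -> Omega -> X -> X) (W : set Omega) (alpha K : Omega -> R).
Variables (Pis : Omega -> X -> X) (rho : Omega -> R).
Hypothesis sepX : separable X.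
Hypothesis imp : invertible_measure_preserving P theta thetaV.
Hypothesis cPhi : measurable_linear_cocycle theta Phi.
Hypothesis ted : tempered_exponential_dichotomy P theta thetaV Phi W alpha K Pis.
Hypothesis rhoP : positive_random_variable rho.
Hypothesis rho_inv : invariant_fun theta rho.
Hypothesis rholt :
  forall w, rho w < (1 - expR (- alpha w)) / (1 + expR (- alpha w)).
Local Notation orb := (orbit theta thetaV).
Local Notation borelX := (g_sigma_algebraType (@open X)).

Let thK : cancel theta thetaV. Proof. by case: imp. Qed.
Let thVK : cancel thetaV theta. Proof. by case: imp. Qed.
Let a w := expR (- alpha w).
Let s w := rate (a w) (rho w).
Let C w := green_constant (a w) (rho w).
Let S w k n := stable_op Phi Pis k (orb n w).
Let U w k n := unstable_op thetaV Phi Pis k (orb n w).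
Let A w n := Phi 1%N (orb n w).
Let Ko w n := K (orb n w).

Let alpha0 w : 0 < alpha w. Proof. by have [[_ ]] := ted_exponent ted. Qed.
Let K0 w : 0 < K w. Proof. by have [[_ ]] := ted_bound ted. Qed.
Let rho0 w : 0 < rho w. Proof. by have [_] := rhoP. Qed.

Let a01 w : 0 < a w < 1.
Proof. by rewrite /a expR_gt0 -[ltRHS]expR0 ltr_expR oppr_lt0 alpha0. Qed.
Let a0 w : 0 < a w. Proof. by have /andP[] := a01 w. Qed.

Let s1 w : 1 < s w. Proof. by have [] := rateP (a01 w) (rho0 w) (rholt w). Qed.
Let as1 w : a w * s w < 1.
Proof. by have [] := rateP (a01 w) (rho0 w) (rholt w). Qed.
Let q1 w : ratio (a w) (s w) (rho w) < 1.
Proof. by have [] := rateP (a01 w) (rho0 w) (rholt w). Qed.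

Let C0 w : 0 <= C w. Proof. exact: green_constant_ge0. Qed.

Let dich w : W w -> dichotomy_on_Z (A w) (S w) (U w) (Ko w) (a w).
Proof. exact: (dichotomy_along_orbit thK thVK cPhi ted). Qed.

Definition perturbed_exponent w : R := ln (s w).
(** The summand [2] accounts for the complementary projection at time zero, through
    [|v| <= 2 * K w * |v|]. *)
Definition perturbed_bound w : R := (C w + 2) * K w.

Lemma perturbed_exponentP :
  positive_random_variable perturbed_exponent /\
  invariant_fun theta perturbed_exponent.
Proof.
have [[ma _] inva] := ted_exponent ted; have [mr _] := rhoP.
split; last by move=> w; rewrite /perturbed_exponent /s /a inva rho_inv.
split; last by move=> w; rewrite ln_gt0.
apply: measurableT_comp; first exact: measurable_ln.
exact: measurable_rate.
Qed.

Lemma perturbed_boundP :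
  positive_random_variable perturbed_bound /\
  tempered P theta thetaV perturbed_bound.
Proof.
have [[ma _] inva] := ted_exponent ted; have [mr _] := rhoP.
have [[mK _] tK] := ted_bound ted.
have C2 w : 0 < C w + 2 by rewrite ltr_wpDl.
split; last first.
  apply: tempered_scale => // w.
  by rewrite /C /a inva rho_inv.
split; last by move=> w; rewrite mulr_gt0.
apply: measurable_funM => //; apply: measurable_funD; last exact: measurable_cst.
exact: measurable_green_constant.
Qed.

Section OneCocycle.
Variable Psi : nat -> Omega -> X -> X.
Hypothesis cPsi : measurable_linear_cocycle theta Psi.
Hypothesis close : forall w, W w ->
  opnorm (generator Phi w \- generator Psi w) <= rho w / K (theta w).
Let B w n := Psi 1%N (orb n w).

Definition orbit_green w (n : int) (v : X) : X :=
  green (A w) (S w) (U w) (B w) 0 v n.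

Let bB w n : bounded_operator (B w n). Proof. exact: cocycle_bounded cPsi _ _. Qed.

Let Wo n w : W w -> W (orb n w).
Proof. exact: (dichotomy_set_in thK ted). Qed.

Lemma generator_close w : W w -> forall (n : int) u,
  Ko w (n + 1) * `|B w n u - A w n u| <= rho w * `|u|.
Proof.
move=> Ww n u; rewrite distrC /Ko (orbitS thVK).
rewrite -(orbit_invariant thVK n w rho_inv).
apply: (opnorm_div_le (T1 := A w n) (T2 := B w n)) => //.
  exact: cocycle_bounded cPhi _ _.
by apply: close; exact: Wo.
Qed.

Let sol w (Ww : W w) := green_solution (dich Ww) (a0 w) (ltW (s1 w)) (as1 w)
  (@bB w) (ltW (rho0 w)) (generator_close Ww) (q1 w).
Let uniq_sol w (Ww : W w) := @solution_unique _ _ _ _ _ _ _ _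
  (dich Ww) (a0 w) (ltW (s1 w)) (as1 w) _ _ (@bB w) (ltW (rho0 w)) (generator_close Ww) (q1 w).

(** A solution along the orbit of [theta w] is, after a shift of the time, a
    solution along the orbit of [w]. *)
Lemma orbit_green_shift w n v : W w ->
  orbit_green (theta w) (n - 1) v = green (A w) (S w) (U w) (B w) 1 v n.
Proof.
move=> Ww; have Wt : W (theta w) by exact: (Wo 1).
have [[M gM] gB] := sol Wt 0 v.
suff h : is_solution (S w) (U w) (a w) (B w) (point_source 1 v)
    (fun k => orbit_green (theta w) (k - 1) v).
  exact: (uniq_sol Ww h (sol Ww 1 v)).
have oS k : orb (k - 1) (theta w) = orb k w by rewrite (orbit_theta thK thVK) subrK.
have [_ inva] := ted_exponent ted.
split.
  exists M => k j; have := gM (k - 1) j.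
  by rewrite /S /U oS /a inva.
move=> k; rewrite addrK /orbit_green; have := gB (k - 1); rewrite subrK => ->.
rewrite /B oS; congr (_ + _); rewrite /point_source.
by rewrite -[in RHS](inj_eq (addIr (-1))) addrK subrr.
Qed.

Lemma orbit_green_bound w n v : W w ->
  `|orbit_green w n v| <= C w * K w * (s w)^-1 ^+ `|n|%N * `|v|.
Proof.
move=> Ww; have := green_bound (dich Ww) (a0 w) (ltW (s1 w)) (as1 w)
  (ltW (rho0 w)) (generator_close Ww) (q1 w) v n (exp_weight (ltW (s1 w)))
  (erefl : _ 0 = 1).
move=> /le_trans; apply; rewrite /C /green_constant /Ko /=.
by rewrite le_eqVlt; apply/orP; left; apply/eqP; rewrite -/(s w); ring.
Qed.

(** ** Measurability of the Green function *)

Let mW : measurable W. Proof. by have [] := ted_set ted. Qed.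

Let along (f : Omega -> borelX) n :
  measurable_fun W f -> measurable_fun W (fun w => f (orb n w)).
Proof.
have [_ thW _] := ted_set ted; have [_ _ mt mtV _] := imp.
exact: measurable_along_orbit.
Qed.

Let mS k n : strongly_measurable W (fun w => S w k n).
Proof.
move=> v; apply: (along (f := fun w => stable_op Phi Pis k w v)).
apply: (measurable_operator_apply sepX (T := Phi k)).
- by move=> x; apply: measurable_funTS; have [_ _ _ h] := cPhi; exact: h.
- by move=> w _; exact: cocycle_bounded cPhi _ _.
- exact: (ted_measurable ted).
Qed.

Let mU k n : strongly_measurable W (fun w => U w k n).
Proof.
move=> v; apply: (along (f := fun w => unstable_op thetaV Phi Pis k w v)).
exact: (ted_neg_measurable ted).
Qed.

Let m_gen (F : nat -> Omega -> X -> X) n : measurable_linear_cocycle theta F ->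
  strongly_measurable W (fun w => F 1%N (orb n w)).
Proof.
move=> [_ _ _ mF] v; apply: (along (f := fun w => F 1%N w v)).
by apply: measurable_funTS; exact: mF.
Qed.

Lemma response_measurable (h : Omega -> int -> X) (M : Omega -> R) :
  (forall n, measurable_fun W (fun w => h w n : borelX)) ->
  (forall w, W w -> 0 <= M w /\ source (Ko w) (M w) (fun=> 1) (h w)) ->
  forall n, measurable_fun W (fun w => response (S w) (U w) (h w) n : borelX).
Proof.
move=> mh hs n.
have r01 w : W w -> 0 <= a w * s w < 1.
  by move=> Ww; rewrite as1 andbT mulr_ge0 // ltW // (lt_trans _ (s1 w)).
apply: (measurable_add sepX (f := fun w => series_sum (stable_term (S w) (h w) n))
  (g := fun w => - series_sum (unstable_term (U w) (h w) n))).
  apply: (measurable_series_sum sepX r01) => [k|w Ww].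
    apply: (measurable_operator_apply sepX (T := fun w => S w k (n - k%:Z))) => //.
    by move=> w Ww; exact: dz_S (dich Ww) _ _.
  have [M0 hM] := hs w Ww.
  exact: (stable_geo (dich Ww) (a0 w) (ltW (s1 w)) (as1 w) M0 (weight1 (ltW (s1 w))) hM).
apply: (measurable_opp sepX); apply: (measurable_series_sum sepX r01) => [k|w Ww].
  apply: (measurable_operator_apply sepX (T := fun w => U w k.+1 (n + k.+1%:Z))) => //.
  by move=> w Ww; exact: dz_U (dich Ww) _ _.
have [M0 hM] := hs w Ww.
exact: (unstable_geo (dich Ww) (a0 w) (ltW (s1 w)) (as1 w) M0 (weight1 (ltW (s1 w))) hM).
Qed.

Lemma orbit_green_measurable n v :
  measurable_fun W (fun w => orbit_green w n v : borelX).
Proof.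
pose f := point_source 0 v : int -> X.
pose M j w := K w * `|v| * s w * ratio (a w) (s w) (rho w) ^+ j.
have s0 w : 0 <= s w by rewrite ltW // (lt_trans _ (s1 w)).
have q0 w : 0 <= ratio (a w) (s w) (rho w).
  rewrite mulr_ge0 ?(ltW (rho0 w)) //; apply: divr_ge0.
    by rewrite addr_ge0 // ltW.
  by rewrite subr_ge0 ltW.
have Kv w : 0 <= K w * `|v| * s w by rewrite mulr_ge0 ?s0 // mulr_ge0 // ltW // K0.
have fs w (Ww : W w) : source (Ko w) (K w * `|v| * s w) (fun=> 1) f.
  exact: (point_source_bound (dich Ww) (ltW (s1 w)) v (weight1 (ltW (s1 w))) (erefl : _ 0 = 1)).
have ps j w : W w -> 0 <= M j w /\
    source (Ko w) (M j w) (fun=> 1) (picard (A w) (S w) (U w) (B w) f j).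
  move=> Ww; split; first by rewrite mulr_ge0 // exprn_ge0.
  exact: (picard_source (dich Ww) (a0 w) (ltW (s1 w)) (as1 w) (ltW (rho0 w))
    (generator_close Ww) (q1 w) (Kv w) (weight1 (ltW (s1 w))) (fs w Ww)).
have mp j m : measurable_fun W
    (fun w => picard (A w) (S w) (U w) (B w) f j m : borelX).
  elim: j m => [|j IH] m; first exact: measurable_cst.
  have mg := response_measurable IH (ps j) (m - 1).
  set x := (X in measurable_fun W X) in mg.
  apply: (measurable_add sepX
    (f := fun w => B w (m - 1) (x w)) (g := fun w => - A w (m - 1) (x w))).
    apply: (measurable_operator_apply sepX (T := fun w => B w (m - 1))) => //.
    exact: m_gen.
  apply: (measurable_opp sepX).
  apply: (measurable_operator_apply sepX (T := fun w => A w (m - 1))) => //.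
    exact: m_gen.
  by move=> w _; exact: cocycle_bounded cPhi _ _.
apply: (measurable_series_sum sepX (r := fun w => ratio (a w) (s w) (rho w))) => //.
- by move=> w _; rewrite q0 q1.
- by move=> j; exact: (response_measurable (mp j) (ps j)).
- move=> w Ww; exact: (solve_geo (dich Ww) (a0 w) (ltW (s1 w)) (as1 w) (ltW (rho0 w))
    (generator_close Ww) (q1 w) (Kv w) (weight1 (ltW (s1 w))) (fs w Ww)).
Qed.

Theorem perturbed_dichotomy :
  tempered_exponential_dichotomy P theta thetaV Psi W
    perturbed_exponent perturbed_bound (fun w => orbit_green w 0).
Proof.
have expE w : expR (- perturbed_exponent w) = (s w)^-1.
  by rewrite expRN lnK // posrE (lt_trans _ (s1 w)).
apply: (green_dichotomy thK thVK cPsi sepX (ted_set ted) perturbed_exponentP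
  perturbed_boundP).
- move=> w n Ww c v v'; exact: (green_linear (dich Ww) (a0 w) (ltW (s1 w)) (as1 w)
    (@bB w) (ltW (rho0 w)) (generator_close Ww) (q1 w)).
- move=> w n v Ww; rewrite expE; apply: le_trans (orbit_green_bound n v Ww) _.
  rewrite ler_wpM2r // ler_wpM2r ?exprn_ge0 ?invr_ge0 ?(ltW (lt_trans _ (s1 w))) //.
  by rewrite ler_wpM2r ?(ltW (K0 w)) // lerDl.
- move=> w v Ww; apply: le_trans (ler_normB _ _) _.
  have nv : `|v| <= 2 * K w * `|v|.
    rewrite -{1}(dz_split (dich Ww) 0 v); apply: le_trans (ler_normD _ _) _.
    have := dz_boundS (dich Ww) 0 0 v; have := dz_boundU (dich Ww) 0 0 v.
    by rewrite expr0 mulr1 /Ko /= => ? ?; lra.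
  have := orbit_green_bound 0 v Ww; rewrite expr0 mulr1 => gb.
  by rewrite /perturbed_bound mulrDl mulrDl [leRHS]addrC lerD.
- move=> w n v Ww; have [_ gB] := sol Ww 0 v; exact: gB.
- move=> w n v Ww; exact: (green_truncate (dich Ww) (a0 w) (ltW (s1 w)) (as1 w)
    (@bB w) (ltW (rho0 w)) (generator_close Ww) (q1 w)).
- move=> w n v Ww; rewrite orbit_green_shift //.
  exact: (green_step (dich Ww) (a0 w) (ltW (s1 w)) (as1 w)
    (@bB w) (ltW (rho0 w)) (generator_close Ww) (q1 w) 0).
- exact: orbit_green_measurable.
Qed.

End OneCocycle.

Lemma orbit_green_lipschitz (Psi Psi' : nat -> Omega -> X -> X) w (eta : R) :
  measurable_linear_cocycle theta Psi -> measurable_linear_cocycle theta Psi' ->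
  (forall v, W v ->
    opnorm (generator Phi v \- generator Psi v) <= rho v / K (theta v)) ->
  (forall v, W v ->
    opnorm (generator Phi v \- generator Psi' v) <= rho v / K (theta v)) ->
  W w -> 0 <= eta ->
  (forall n, opnorm (generator Psi (orb n w) \- generator Psi' (orb n w))
    <= eta / K (theta (orb n w))) ->
  opnorm (orbit_green Psi w 0 \- orbit_green Psi' w 0) <= eta * C w ^+ 2 * K w.
Proof.
move=> cP cP' cl cl' Ww eta0 ce.
apply: opnorm_le => [|v /=].
  by rewrite mulr_ge0 ?(ltW (K0 w)) // mulr_ge0 // exprn_ge0 // C0.
have ceq (n : int) u :
    Ko w (n + 1) * `|Psi 1%N (orb n w) u - Psi' 1%N (orb n w) u| <= eta * `|u|.
  rewrite /Ko (orbitS thVK).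
  apply: (opnorm_div_le (T1 := Psi 1%N (orb n w)) (T2 := Psi' 1%N (orb n w))) => //.
  - exact: cocycle_bounded cP _ _.
  - exact: cocycle_bounded cP' _ _.
  - exact: ce.
have := green_perturbation (dich Ww) (a0 w) (ltW (s1 w)) (as1 w) 0 v
  (fun n => cocycle_bounded cP 1 (orb n w)) (fun n => cocycle_bounded cP' 1 (orb n w))
  (ltW (rho0 w)) eta0 (q1 w) (generator_close cP cl Ww) (generator_close cP' cl' Ww)
  ceq 0.
move=> /le_trans; apply; rewrite /C /green_constant -/(s w) /Ko /=.
set c := (_ / _ / _).
have c0 : 0 <= c.
  apply: divr_ge0; last by rewrite subr_ge0 ltW.
  apply: divr_ge0; last by rewrite subr_ge0 ltW.
  by rewrite addr_ge0 // ltW // (lt_trans _ (s1 w)).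
have s2 : 1 <= s w by exact: ltW.
have Kv : 0 <= K w * `|v| by rewrite mulr_ge0 // ltW.
rewrite (_ : eta * (s w * c) ^+ 2 * K w * `|v| =
  s w * (eta * (K w * `|v| * s w * c) * c)); last by ring.
apply: ler_peMl => //; rewrite mulr_ge0 // mulr_ge0 // mulr_ge0 // mulr_ge0 //.
exact: le_trans s2.
Qed.

End Roughness.

Theorem corollary1 (R : realType) (X : completeNormedModType R)
    (d : measure_display) (Omega : measurableType d)
    (P : {measure set Omega -> \bar R}) (theta thetaV : Omega -> Omega)
    (Xi : normedModType R)
    (Phi : nat -> Omega -> X -> X) (Psi : Xi -> nat -> Omega -> X -> X)
    (W : set Omega) (alpha K : Omega -> R) (Pis : Omega -> X -> X)
    (rho upsilon : Omega -> R) (sigma : R) :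
  separable X ->
  invertible_measure_preserving P theta thetaV ->
  measurable_linear_cocycle theta Phi ->
  (forall xi, measurable_linear_cocycle theta (Psi xi)) ->
  tempered_exponential_dichotomy P theta thetaV Phi W alpha K Pis ->
  positive_random_variable rho ->
  invariant_fun theta rho ->
  (forall w, rho w < (1 - expR (- alpha w)) / (1 + expR (- alpha w))) ->
  (forall w xi, W w ->
    opnorm (generator Phi w \- generator (Psi xi) w) <= rho w / K (theta w)) ->
  positive_random_variable upsilon ->
  invariant_fun theta upsilon ->
  0 < sigma <= 1 ->
  (forall w xi1 xi2, W w ->
    opnorm (generator (Psi xi1) w \- generator (Psi xi2) w)
      <= upsilon w * `|xi1 - xi2| `^ sigma / K (theta w)) ->
  exists (alpha' K' : Omega -> R) (Pis' : Xi -> Omega -> X -> X),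
    (forall xi, tempered_exponential_dichotomy P theta thetaV
                  (Psi xi) W alpha' K' (Pis' xi)) /\
    (forall w, W w -> hoelder_continuous sigma (fun xi => Pis' xi w)).
Proof.
move=> sepX imp cPhi cPsi ted rhoP rho_inv rholt close upsP ups_inv _ hold.
exists (perturbed_exponent alpha rho), (perturbed_bound alpha K rho).
exists (fun xi w => orbit_green theta thetaV Phi Pis (Psi xi) w 0).
split=> [xi|w Ww].
  apply: (perturbed_dichotomy sepX imp cPhi ted rhoP rho_inv rholt (cPsi xi)).
  by move=> w; exact: close.
have [_ ups0] := upsP; have [thK thVK _ _ _] := imp.
exists (upsilon w * green_constant (expR (- alpha w)) (rho w) ^+ 2 * K w).
move=> xi1 xi2.
have ui n : upsilon (orbit theta thetaV n w) = upsilon w.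
  exact: (orbit_invariant thVK n w ups_inv).
have e0 : 0 <= upsilon w * `|xi1 - xi2| `^ sigma.
  by rewrite mulr_ge0 ?powR_ge0 // ltW.
apply: le_trans (orbit_green_lipschitz imp cPhi ted rhoP rho_inv rholt
  (cPsi xi1) (cPsi xi2) (fun v => close v xi1) (fun v => close v xi2) Ww e0 _) _.
  move=> n; rewrite -(ui n); apply: hold; exact: (dichotomy_set_in thK ted).
by rewrite le_eqVlt; apply/orP; left; apply/eqP; ring.
Qed.
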